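(* For any $\mu\in\Lambda^+$, the $\mathbb{C}$-algebra epimorphism $\Upsilon_{-\mu}\colon Y_{-\mu}(\mathfrak{gl}_n)\to Y^{\mathrm{rtt}}_{-\mu}(\mathfrak{gl}_n)$, determined by $E_i(z)\mapsto e_{i,i+1}(z)$, $F_i(z)\mapsto f_{i+1,i}(z)$, $D_j(z)\mapsto g_j(z)$, is an isomorphism.
   Context: Let $n\ge2$, $\Lambda=\bigoplus_{j=1}^n\mathbb{Z}\epsilon_j$, $\epsilon^\vee_j$ the dual basis, $\alpha^\vee_i=\epsilon^\vee_i-\epsilon^\vee_{i+1}$, $\Lambda^+=\{\nu:\alpha^\vee_i(\nu)\ge0\ \forall 1\le i\le n-1\}$. Drinfeld side: for $\nu\in\Lambda$ with $d_j:=\epsilon^\vee_j(\nu)$, $Y_\nu(\mathfrak{gl}_n)$ is the $\mathbb{C}$-algebra generated by $E_i^{(r)},F_i^{(r)}$ ($1\le i<n$, $r\ge1$), $D_i^{(s)}$ ($s\ge d_i$), $\widetilde D_i^{(s)}$ ($s\ge-d_i$) subject to: (Y0) $D_i^{(d_i)}=1$, $\sum_{t=d_i}^{r+d_i}D_i^{(t)}\widetilde D_i^{(r-t)}=-\delta_{r,0}$, $[D_i^{(r)},D_j^{(s)}]=0$; (Y1) $[E_i^{(r)},F_j^{(s)}]=-\delta_{i,j}\sum_{t=-d_i}^{r+s-1-d_{i+1}}\widetilde D_i^{(t)}D_{i+1}^{(r+s-t-1)}$; (Y2) $[D_i^{(r)},E_j^{(s)}]=(\delta_{i,j+1}-\delta_{i,j})\sum_{t=d_i}^{r-1}D_i^{(t)}E_j^{(r+s-t-1)}$;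 (Y3) $[D_i^{(r)},F_j^{(s)}]=(\delta_{i,j}-\delta_{i,j+1})\sum_{t=d_i}^{r-1}F_j^{(r+s-t-1)}D_i^{(t)}$; (Y4) $[E_i^{(r)},E_i^{(s)}]=\sum_{t=1}^{r-1}E_i^{(t)}E_i^{(r+s-t-1)}-\sum_{t=1}^{s-1}E_i^{(t)}E_i^{(r+s-t-1)}$; (Y5) $[F_i^{(r)},F_i^{(s)}]=\sum_{t=1}^{s-1}F_i^{(r+s-t-1)}F_i^{(t)}-\sum_{t=1}^{r-1}F_i^{(r+s-t-1)}F_i^{(t)}$; (Y6) $[E_i^{(r+1)},E_{i+1}^{(s)}]-[E_i^{(r)},E_{i+1}^{(s+1)}]=-E_i^{(r)}E_{i+1}^{(s)}$; (Y7) $[F_i^{(r+1)},F_{i+1}^{(s)}]-[F_i^{(r)},F_{i+1}^{(s+1)}]=F_{i+1}^{(s)}F_i^{(r)}$; (Y8),(Y9) $[E_i^{(r)},E_j^{(s)}]=0=[F_i^{(r)},F_j^{(s)}]$ if $|i-j|>1$; (Y10),(Y11) for $|i-j|=1$: $[E_i^{(r)},[E_i^{(s)},E_j^{(t)}]]+[E_i^{(s)},[E_i^{(r)},E_j^{(t)}]]=0$, and likewise for $F$. Series: $E_i(z)=\sum_{r\ge1}E_i^{(r)}z^{-r}$, $F_i(z)=\sum_{r\ge1}F_i^{(r)}z^{-r}$, $D_i(z)=\sum_{r\ge d_i}D_i^{(r)}z^{-r}$. RTT side: for $\mu\in\Lambda^+$ put $c_i:=\epsilon^\vee_i(\mu)$.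 $Y^{\mathrm{rtt}}_{-\mu}(\mathfrak{gl}_n)$ is the $\mathbb{C}$-algebra generated by $t_{ij}^{(r)}$ ($1\le i,j\le n$, $r\in\mathbb{Z}$), with $T(z)=\sum_{i,j}t_{ij}(z)\otimes E_{ij}$, $t_{ij}(z)=\sum_{r\in\mathbb{Z}}t_{ij}^{(r)}z^{-r}$, subject to: (1) $R(z-w)T_1(z)T_2(w)=T_2(w)T_1(z)R(z-w)$, $R(z)=z\cdot\mathrm{Id}+P$, $P=\sum_{i,j}E_{ij}\otimes E_{ji}$; (2) the relations expressing that $T(z)=F(z)G(z)E(z)$ with $F(z)=\sum_iE_{ii}+\sum_{i<j}f_{ji}(z)\otimes E_{ji}$, $G(z)=\sum_ig_i(z)\otimes E_{ii}$, $E(z)=\sum_iE_{ii}+\sum_{i<j}e_{ij}(z)\otimes E_{ij}$, $e_{ij}(z)=\sum_{r\ge1}e^{(r)}_{ij}z^{-r}$, $f_{ji}(z)=\sum_{r\ge1}f^{(r)}_{ji}z^{-r}$, $g_i(z)=z^{c_i}+\sum_{r\ge1-c_i}g^{(r)}_iz^{-r}$ for some elements $e^{(r)}_{ij},f^{(r)}_{ji},g^{(r)}_i$ of the algebra. *)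

(* Defs.v *)
From HB Require Import structures.
From mathcomp Require Import all_boot all_order all_algebra.
From mathcomp Require Import complex.
From mathcomp Require Import Rstruct.
From Stdlib Require Rdefinitions.
Set Implicit Arguments. Unset Strict Implicit. Unset Printing Implicit Defensive.
Import Order.TTheory GRing.Theory Num.Theory.
Local Open Scope ring_scope.

Definition CC : fieldType := (Rdefinitions.R)[i].

Section Series.
Variable A : pzRingType.

Definition isum (a b : int) (f : int -> A) : A :=
  if (a <= b)%R then \sum_(k < (absz (b - a)).+1) f (a + k%:Z) else 0.

Definition comm (x y : A) : A := x * y - y * x.

Definition kd (x y : int) : A := if x == y then 1 else 0.
End Series.

(* Drinfeld side.  Indices i are the paper's 1-based indices (nat).    *)
(* d j = eps_j^vee(nu); superscripts r are integers.  A family of      *)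
(* elements E F D Dt : nat -> int -> A (E i r = E_i^{(r)}, etc.);      *)
(* only indices in the generator ranges are ever used.                *)
Section Drinfeld.
Variables (A : pzRingType) (n : nat) (d : nat -> int).
Variables (E F D Dt : nat -> int -> A).

Definition idx_simple (i : nat) := (1 <= i < n)%N.
Definition idx_diag (i : nat) := (1 <= i <= n)%N.

Definition Drinfeld_rels : Prop :=
  (forall i, idx_diag i -> D i (d i) = 1) /\
  (forall i r, idx_diag i ->
     isum (d i) (r + d i) (fun t => D i t * Dt i (r - t)) = - kd A r 0) /\
  (forall i j r s, idx_diag i -> idx_diag j -> d i <= r -> d j <= s ->
     comm (D i r) (D j s) = 0) /\
  (forall i j r s, idx_simple i -> idx_simple j -> 1 <= r -> 1 <= s ->
     comm (E i r) (F j s) =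
       - (if i == j then
            isum (- d i) (r + s - 1 - d i.+1)
                 (fun t => Dt i t * D i.+1 (r + s - t - 1))
          else 0)) /\
  (forall i j r s, idx_diag i -> idx_simple j -> d i <= r -> 1 <= s ->
     comm (D i r) (E j s) =
       (kd A i%:Z j.+1%:Z - kd A i%:Z j%:Z) *
         isum (d i) (r - 1) (fun t => D i t * E j (r + s - t - 1))) /\
  (forall i j r s, idx_diag i -> idx_simple j -> d i <= r -> 1 <= s ->
     comm (D i r) (F j s) =
       (kd A i%:Z j%:Z - kd A i%:Z j.+1%:Z) *
         isum (d i) (r - 1) (fun t => F j (r + s - t - 1) * D i t)) /\
  (forall i r s, idx_simple i -> 1 <= r -> 1 <= s ->
     comm (E i r) (E i s) =
       isum 1 (r - 1) (fun t => E i t * E i (r + s - t - 1))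
     - isum 1 (s - 1) (fun t => E i t * E i (r + s - t - 1))) /\
  (forall i r s, idx_simple i -> 1 <= r -> 1 <= s ->
     comm (F i r) (F i s) =
       isum 1 (s - 1) (fun t => F i (r + s - t - 1) * F i t)
     - isum 1 (r - 1) (fun t => F i (r + s - t - 1) * F i t)) /\
  (forall i r s, idx_simple i -> idx_simple i.+1 -> 1 <= r -> 1 <= s ->
     comm (E i (r + 1)) (E i.+1 s) - comm (E i r) (E i.+1 (s + 1)) =
       - (E i r * E i.+1 s)) /\
  (forall i r s, idx_simple i -> idx_simple i.+1 -> 1 <= r -> 1 <= s ->
     comm (F i (r + 1)) (F i.+1 s) - comm (F i r) (F i.+1 (s + 1)) =
       F i.+1 s * F i r) /\
  (forall i j r s, idx_simple i -> idx_simple j -> (1 < `|i%:Z - j%:Z|)%R ->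
     1 <= r -> 1 <= s ->
     comm (E i r) (E j s) = 0 /\ comm (F i r) (F j s) = 0) /\
  (forall i j r s t, idx_simple i -> idx_simple j -> `|i%:Z - j%:Z| = 1 ->
     1 <= r -> 1 <= s -> 1 <= t ->
     comm (E i r) (comm (E i s) (E j t)) + comm (E i s) (comm (E i r) (E j t)) = 0 /\
     comm (F i r) (comm (F i s) (F j t)) + comm (F i s) (comm (F i r) (F j t)) = 0).
End Drinfeld.

Definition agree_drinfeld (B : pzRingType) (n : nat) (d : nat -> int)
  (E F D Dt E' F' D' Dt' : nat -> int -> B) : Prop :=
  (forall i r, idx_simple n i -> 1 <= r -> E i r = E' i r /\ F i r = F' i r) /\
  (forall i r, idx_diag n i -> d i <= r -> D i r = D' i r) /\
  (forall i r, idx_diag n i -> - d i <= r -> Dt i r = Dt' i r).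

Definition fam_map (A B : pzRingType) (phi : A -> B) (X : nat -> int -> A) :
  nat -> int -> B := fun i r => phi (X i r).

(* (A; E, F, D, Dt) is the C-algebra presented by the generators
   E_i^{(r)}, F_i^{(r)} (1 <= i < n, r >= 1), D_i^{(s)} (s >= d_i),
   Dt_i^{(s)} (s >= -d_i) subject to (Y0)-(Y11), i.e. it is Y_nu(gl_n)
   (with d_j = eps_j^vee(nu)), characterized by its universal property. *)
Definition is_Drinfeld_shifted_yangian (n : nat) (d : nat -> int)
  (A : algType CC) (E F D Dt : nat -> int -> A) : Prop :=
  Drinfeld_rels n d E F D Dt /\
  forall (B : algType CC) (E' F' D' Dt' : nat -> int -> B),
    Drinfeld_rels n d E' F' D' Dt' ->
    exists phi : {lrmorphism A -> B},
      agree_drinfeld n d (fam_map phi E) (fam_map phi F)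
                         (fam_map phi D) (fam_map phi Dt) E' F' D' Dt' /\
      forall psi : {lrmorphism A -> B},
        agree_drinfeld n d (fam_map psi E) (fam_map psi F)
                           (fam_map psi D) (fam_map psi Dt) E' F' D' Dt' ->
        forall x, psi x = phi x.

(* RTT side.  c j = eps_j^vee(mu).  Families t e f g : nat -> nat -> int -> A
   resp. nat -> int -> A with t i j r = t_ij^{(r)}, e i j r = e_ij^{(r)}
   (i < j, r >= 1), f j i r = f_ji^{(r)} (i < j, r >= 1),
   g i r = g_i^{(r)} (r >= 1 - c_i).                                     *)
Section RTT.
Variables (A : pzRingType) (n : nat) (c : nat -> int).
Variables (t e f : nat -> nat -> int -> A) (g : nat -> int -> A).

(* full coefficient sequences of the series e_kj(z) (with e_jj(z) = 1),
   f_ik(z) (with f_ii(z) = 1) and g_k(z) = z^{c_k} + sum_{r>=1-c_k} ...;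
   the coefficient of z^{-r} *)
Definition ehat (k j : nat) (r : int) : A :=
  if k == j then kd A r 0 else if (1 <= r)%R then e k j r else 0.
Definition fhat (i k : nat) (r : int) : A :=
  if i == k then kd A r 0 else if (1 <= r)%R then f i k r else 0.
Definition ghat (k : nat) (r : int) : A :=
  if r == - c k then 1 else if (1 - c k <= r)%R then g k r else 0.

(* coefficient of z^{-r} in f_ik(z) g_k(z) e_kj(z)  (all other terms vanish) *)
Definition fge_coef (i k j : nat) (r : int) : A :=
  isum 0 (r + c k) (fun a =>
    isum (- c k) (r - a) (fun b => fhat i k a * ghat k b * ehat k j (r - a - b))).

Definition RTT_rels : Prop :=
  (* R(z-w) T_1(z) T_2(w) = T_2(w) T_1(z) R(z-w), R(z) = z Id + P, written
     entrywise (entry E_ab (x) E_cd) and coefficientwise (z^{-r} w^{-s}):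
     (z-w) t_ab(z) t_cd(w) + t_cb(z) t_ad(w)
        = (z-w) t_cd(w) t_ab(z) + t_cb(w) t_ad(z). *)
  (forall a b c' d' (r s : int), idx_diag n a -> idx_diag n b ->
     idx_diag n c' -> idx_diag n d' ->
     t a b (r + 1) * t c' d' s - t a b r * t c' d' (s + 1) + t c' b r * t a d' s
     = t c' d' s * t a b (r + 1) - t c' d' (s + 1) * t a b r + t c' b s * t a d' r) /\
  (* T(z) = F(z) G(z) E(z), entrywise and coefficientwise *)
  (forall i j (r : int), idx_diag n i -> idx_diag n j ->
     t i j r = \sum_(1 <= k < (minn i j).+1) fge_coef i k j r).
End RTT.

(* (A; t, e, f, g) is the C-algebra Y^rtt_{-mu}(gl_n): generated by the
   t_ij^{(r)} subject to the RTT relation and to the existence of the Gauss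
   decomposition T(z) = F(z)G(z)E(z) of the prescribed shape.  We present it
   with the Gauss coordinates e, f, g as additional generators (they are the
   "some elements" of the definition), characterized by the universal
   property. *)
Definition agree_rtt (B : pzRingType) (n : nat) (c : nat -> int)
  (t e f : nat -> nat -> int -> B) (g : nat -> int -> B)
  (t' e' f' : nat -> nat -> int -> B) (g' : nat -> int -> B) : Prop :=
  (forall i j r, idx_diag n i -> idx_diag n j -> t i j r = t' i j r) /\
  (forall i j r, idx_diag n i -> idx_diag n j -> (i < j)%N -> 1 <= r ->
     e i j r = e' i j r /\ f j i r = f' j i r) /\
  (forall i r, idx_diag n i -> 1 - c i <= r -> g i r = g' i r).

Definition fam_map2 (A B : pzRingType) (phi : A -> B) (X : nat -> nat -> int -> A) :
  nat -> nat -> int -> B := fun i j r => phi (X i j r).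

Definition is_RTT_shifted_yangian (n : nat) (c : nat -> int)
  (A : algType CC) (t e f : nat -> nat -> int -> A) (g : nat -> int -> A) : Prop :=
  RTT_rels n c t e f g /\
  forall (B : algType CC) (t' e' f' : nat -> nat -> int -> B) (g' : nat -> int -> B),
    RTT_rels n c t' e' f' g' ->
    exists phi : {lrmorphism A -> B},
      agree_rtt n c (fam_map2 phi t) (fam_map2 phi e) (fam_map2 phi f)
                    (fam_map phi g) t' e' f' g' /\
      forall psi : {lrmorphism A -> B},
        agree_rtt n c (fam_map2 psi t) (fam_map2 psi e) (fam_map2 psi f)
                      (fam_map psi g) t' e' f' g' ->
        forall x, psi x = phi x.

Definition dominant (n : nat) (c : nat -> int) : Prop :=
  forall i, (1 <= i < n)%N -> c i.+1 <= c i.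

(* Main.v *)
Require Import Defs.
From HB Require Import structures.
From mathcomp Require Import all_boot all_order all_algebra.
From mathcomp Require Import boolp complex Rstruct zify.
From Stdlib Require Ncring Ncring_tac.
Import GRing.Theory Num.Theory.
Local Open Scope ring_scope.

Set Implicit Arguments.
Unset Strict Implicit.

(* An inverse of Upsilon comes from a solution of the RTT relations inside Y.
   With x_i = E_i^(1) and y_i = F_i^(1), set e_{k,m+1} = [x_m, e_{km}],
   f_{m+1,k} = - [y_m, f_{mk}] and T = FGE.  The point is that ad x_i and ad y_i act on
   the entries of T essentially by elementary matrices,
     [x_i, t_ab] = d_{bi} t_{a,i+1} - d' d_{a,i+1} t_{ib}
   (with d' = 1 if c_i = c_{i+1} and d' = 0 otherwise, and similarly for y_i); for
   rows and columns <= m+1 this follows from the case m by the Serre relations alone,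
   because the new row and column are commutators of x_m and y_m with old ones.  The
   defect Q_{rs}(ab,cd) of the RTT relation is then covariant under ad x_i and ad y_i, so
   that its vanishing propagates from the 2 x 2 block, where it is checked by hand, to
   all of T.  No PBW theorem is needed.

   Conversely, a solution of the RTT relations is determined by its g_i, e_{i,i+1} and
   f_{i+1,i}: if two solutions agree up to m, the difference of their columns m+1 is
   A eta, with A the common m x m block and eta_m = 0; the RTT relation and the
   injectivity of A force A eta = 0.  Hence both composites are the identity on
   generators. *)

(** Covariance comes from R(z) = z Id + P commuting with e ⊗ 1 + 1 ⊗ e for every constant matrix e.
    The bracket with x_i is T -> T e_{i+1,i} - d' e_{i+1,i} T, and the bracket with y_i is T -> d' T
    e_{i,i+1} - e_{i,i+1} T, so each passes through the RTT defect.

    The flag d' is what the shift changes. The series [x_i, F_i(z)] is D_i(z)^-1 D_{i+1}(z) without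
    its constant term, and that constant term is 1 if c_i = c_{i+1} and 0 if c_{i+1} < c_i. In the
    second case [x_i, y_i] is central and half of the action disappears.

    The Serre relations enter as 2 u = 0, at the first coefficients and again in the induction on m,
    so 2 must be cancellable. Dominance makes c_1 the largest of the c_k, so that z^(-c_1) T(z) is a
    matrix of power series in z^-1.

    In the converse direction, the RTT relation with first factor t_{am}^(r), a <= m, acts on both
    solutions by the same derivation; since eta_m = 0, it expresses the difference of the
    coefficients of t_{a,m+1} through the eta_d, whose constant terms vanish. *)

Definition ncring_ops (R : pzRingType) :
  @Ncring.Ring_ops R 0 1 +%R *%R (fun x y => x - y) -%R eq :=
  Ncring.Build_Ring_ops _ _ _ _ _ _ _.

Lemma ncring_ring (R : pzRingType) : Ncring.Ring (Ro := ncring_ops R).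
Proof.
split.
- exact: RelationClasses.eq_equivalence.
- by move=> ? ? -> ? ? ->.
- by move=> ? ? -> ? ? ->.
- by move=> ? ? -> ? ? ->.
- by move=> ? ? ->.
- exact: add0r.
- exact: addrC.
- exact: addrA.
- exact: mul1r.
- exact: mulr1.
- exact: mulrA.
- exact: mulrDl.
- by move=> *; exact: mulrDr.
- by [].
- exact: subrr.
Qed.

#[local] Existing Instance ncring_ops.
#[local] Existing Instance ncring_ring.

(* Locked, since unification would otherwise see a bracket as a difference. *)
HB.lock Definition lie (L : pzRingType) (a b : L) : L := a * b - b * a.
Arguments lie {L} a b.

Lemma lieE (L : pzRingType) (a b : L) : lie a b = a * b - b * a.
Proof. by rewrite lie.unlock. Qed.

Ltac ncring := rewrite ?lieE; Ncring_tac.non_commutative_ring.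

(** Restricting [lia] to these goals lets [try natlia] after a conditional [rewrite] close the side
    conditions and leave the ring equation alone. *)
Ltac natlia := match goal with
  | |- is_true _ => lia
  | |- not (@eq nat _ _) => lia
  | |- @eq nat _ _ => lia
  end.

(** * Commutators *)

Section LieTheory.
Variable L : pzRingType.
Implicit Types a b c : L.

Lemma lie0r a : lie a 0 = 0. Proof. ncring. Qed.
Lemma lie0l a : lie 0 a = 0. Proof. ncring. Qed.
Lemma lierD a b c : lie a (b + c) = lie a b + lie a c. Proof. ncring. Qed.
Lemma lierB a b c : lie a (b - c) = lie a b - lie a c. Proof. ncring. Qed.
Lemma lierN a b : lie a (- b) = - lie a b. Proof. ncring. Qed.
Lemma lierM a b c : lie a (b * c) = lie a b * c + b * lie a c.
Proof. ncring. Qed.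
Lemma lieC a b : lie a b = - lie b a. Proof. ncring. Qed.
Lemma lie_jacobi a b c :
  lie a (lie b c) = lie (lie a b) c + lie b (lie a c).
Proof. ncring. Qed.
Lemma lier_sum a (I : Type) (r : seq I) (P : pred I) (F : I -> L) :
  lie a (\sum_(i <- r | P i) F i) = \sum_(i <- r | P i) lie a (F i).
Proof. by rewrite lieE mulr_sumr mulr_suml -sumrB; apply: eq_bigr => i _; rewrite lieE. Qed.
Lemma lierMn a b n : lie a (b *+ n) = lie a b *+ n.
Proof. by rewrite !lieE mulrnAr mulrnAl -mulrnBl. Qed.
(** Row statements are reduced to column statements through the converse ring: reversing products
    and transposing T exchanges the roles of x and y. *)
Lemma lie_converse (a b : L^c) : lie a b = - lie (a : L) (b : L).
Proof. by rewrite !lieE opprB. Qed.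
Lemma lie_swap0 a b : lie a b = 0 -> lie b a = 0.
Proof. by rewrite (lieC b) => ->; rewrite oppr0. Qed.

Lemma lie0_lie a b c : lie a b = 0 -> lie a c = 0 -> lie a (lie b c) = 0.
Proof. by move=> hb hc; rewrite lie_jacobi hb hc lie0r addr0 lieC lie0r oppr0. Qed.

Lemma lie0M a b c : lie a b = 0 -> lie a c = 0 -> lie a (b * c) = 0.
Proof. by move=> hb hc; rewrite lierM hb hc mul0r mulr0 addr0. Qed.

(** Since ad is a Lie homomorphism, the hypothesis makes B B A - 2 B A B + A B B vanish for A = ad a
    and B = ad b; this is that identity solved for B B A. *)
Lemma serre_ad a b c : lie b (lie b a) = 0 ->
  lie b (lie b (lie a c)) =
  lie b (lie a (lie b c)) + lie b (lie a (lie b c)) - lie a (lie b (lie b c)).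
Proof.
move=> h; apply/subr0_eq; transitivity (lie (lie b (lie b a)) c); first by ncring.
by rewrite h lie0l.
Qed.
End LieTheory.

(** * Induction step for the action of the x_i on rows and columns *)

Section ColumnAction.
Variables (L : pzRingType) (x : nat -> L) (t : nat -> nat -> L) (dl : nat -> bool).

Definition col_act (m : nat) : Prop := forall i a b,
  (0 < i < m)%N -> (0 < a <= m)%N -> (0 < b <= m)%N ->
  lie (x i) (t a b) = t a i.+1 *+ (b == i) - t i b *+ ((a == i.+1) && dl i).

Hypothesis two_tf : forall z : L, z + z = 0 -> z = 0.

(** The new column is [x_m, column m] and the new row is - [y_m, row m]. For i < q, x_i commutes
    with x_m and y_m, so Jacobi suffices. On the new row, x_m leaves by Jacobi a bracket with
    [x_m, y_m], whence the hypothesis on that element. What remains are x_q and x_m on the new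
    column and corner; there the Serre relations between x_q and x_m decide. *)
Lemma col_act_step (y : nat -> L) (q : nat) (m := q.+1) : (0 < q)%N ->
  col_act m ->
  lie (x m) (lie (x m) (x q)) = 0 -> lie (x q) (lie (x q) (x m)) = 0 ->
  (forall i, (0 < i < q)%N -> lie (x i) (x m) = 0) ->
  (forall i, (0 < i < m)%N -> lie (x i) (y m) = 0) ->
  (forall a b, (0 < a <= m)%N -> (0 < b < m)%N -> lie (x m) (t a b) = 0) ->
  (forall a b, (0 < a < m)%N -> (0 < b <= m)%N -> lie (y m) (t a b) = 0) ->
  (forall a, (0 < a <= m)%N -> lie (x m) (t a m) = t a m.+1) ->
  (forall b, (0 < b <= m)%N -> lie (y m) (t m b) = - t m.+1 b) ->
  lie (x m) (t m.+1 m) = t m.+1 m.+1 - t m m *+ dl m ->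
  (forall b, (0 < b <= m)%N ->
     lie (lie (x m) (y m)) (t m b) = t m b *+ ((b < m)%N && dl m)) ->
  col_act m.+1.
Proof.
move=> q0 IH Smq Sqm xx xy xA yA Bdef Cdef Ddef kt.
have qm : (0 < q < m)%N by rewrite q0 ltnS leqnn.
have m0 : (0 < m <= m)%N by rewrite leqnn.
have q0m : (0 < q <= m)%N by rewrite q0 leqnSn.
have nqm : (q == m) = false by rewrite ltn_eqF.
have nmq : (m == q) = false by rewrite eq_sym.
(* Up to a multiple of t_{qq}, column m is [x_q, column q]. Since x_m kills column q, the Serre
   relation makes [x_m, [x_m, column m]] vanish. *)
have xB a : (0 < a <= m)%N -> lie (x m) (t a m.+1) = 0.
  move=> ha; rewrite -Bdef // .
  have e := IH q a q qm ha q0m; rewrite eqxx mulr1n in e.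
  have -> : t a m = lie (x q) (t a q) + t q q *+ ((a == m) && dl q) by rewrite e addrNK.
  rewrite !lierD. rewrite serre_ad // !lierMn (xA a q) // (xA q q) //.
  by rewrite !lie0r ?mul0rn ?lie0r ?subr0 ?addr0.
have xC b : (0 < b <= m)%N ->
    lie (x m) (t m.+1 b) = t m.+1 m.+1 *+ (b == m) - t m b *+ dl m.
  move=> hb; case: (b =P m) => [->|/eqP nb]; first exact: Ddef.
  have lb : (b < m)%N by rewrite ltn_neqAle nb; case/andP: hb.
  rewrite -[t m.+1 b]opprK -Cdef // lierN lie_jacobi kt // lb xA // ?lie0r ?mulr0n ?sub0r ?addr0 //.
  by case/andP: hb => ->.
(* Here the Serre relation is quadratic in x_q and its middle term carries a factor 2: it yields
   twice the claim, hence [two_tf]. *)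
have xqB a : (0 < a <= m)%N -> lie (x q) (t a m.+1) = - (t q m.+1 *+ ((a == m) && dl q)).
  move=> ha; rewrite -(Bdef a ha) -(Bdef q q0m).
  have e := IH q a q qm ha q0m; rewrite eqxx mulr1n in e.
  have e' := IH q a m qm ha m0; rewrite nmq mulr0n in e'.
  have e'' := IH q q q qm q0m q0m; rewrite eqxx mulr1n nqm mulr0n subr0 in e''.
  apply/subr0_eq/two_tf; rewrite opprK.
  have h2 : lie (x m) (t a q) = 0 by apply: xA.
  have h3 : lie (x m) (t q q) = 0 by apply: xA.
  move: (serre_ad (t a q) Sqm).
  rewrite h2 !lie0r e !lierB lierMn h3 mul0rn lie0r subr0 !lierMn e' e'' lierB lie0r lierMn.
  by move=> ->; ncring.
have lC i b : (0 < i < m)%N -> (0 < b <= m)%N ->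
    lie (x i) (t m.+1 b) = t m.+1 i.+1 *+ (b == i).
  move=> hi hb; rewrite -[t m.+1 b]opprK -Cdef // lierN lie_jacobi xy //.
  rewrite (IH i m b hi m0 hb) lierB !lierMn (yA i b) // mul0rn Cdef; last lia.
  by rewrite lie0l add0r subr0 mulNrn opprK.
have lB i a : (0 < i < m)%N -> (0 < a <= m)%N ->
    lie (x i) (t a m.+1) = - (t i m.+1 *+ ((a == i.+1) && dl i)).
  move=> hi ha; case: (i =P q) => [->|/eqP niq]; first exact: xqB.
  have hiq : (0 < i < q)%N by lia.
  have hi' : (0 < i <= m)%N by lia.
  rewrite -(Bdef a ha) -(Bdef i hi') lie_jacobi xx // (IH i a m hi ha m0).
  have -> : (m == i) = false by lia.
  by rewrite mulr0n lierB lie0r sub0r lierMn lie0l add0r.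
(* With t_{m+1,m} = [x_q, t_{m+1,q}], the Serre relation contributes - 2 d' t_{m,m+1}, and the
   correction term d' t_{mm} of the corner gives one of the two back. *)
have xmD : lie (x m) (t m.+1 m.+1) = - (t m m.+1 *+ dl m).
  have -> : t m.+1 m.+1 = lie (x m) (t m.+1 m) + t m m *+ dl m by rewrite Ddef subrK.
  rewrite lierD lierMn (Bdef m) //.
  have -> : t m.+1 m = lie (x q) (t m.+1 q) by rewrite lC // eqxx.
  have e := IH q m q qm m0 q0m; rewrite !eqxx mulr1n /= in e.
  rewrite serre_ad // xC // nqm mulr0n sub0r !lierN !lierMn xA // lie0r !mul0rn oppr0 subr0.
  rewrite e lierB lierMn (Bdef m) // (xA q q) // mul0rn subr0.
  ncring.
have xlD i : (0 < i < m)%N -> lie (x i) (t m.+1 m.+1) = 0.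
  move=> hi.
  have -> : t m.+1 m.+1 = lie (x m) (t m.+1 m) + t m m *+ dl m by rewrite Ddef subrK.
  case: (i =P q) => [->|/eqP niq]; last first.
    have hiq : (0 < i < q)%N by lia.
    rewrite lierD lierMn lie_jacobi xx // lC // (IH i m m hi m0 m0).
    have -> : (m == i) = false by lia.
    have -> : (m == i.+1) = false by lia.
    by rewrite !mulr0n subr0 lie0l lie0r mul0rn !addr0.
  have e := IH q m q qm m0 q0m; rewrite !eqxx mulr1n /= in e.
  have e' := IH q m m qm m0 m0; rewrite nmq eqxx /= mulr0n sub0r in e'.
  have e'' := IH q q q qm q0m q0m; rewrite eqxx mulr1n nqm mulr0n subr0 in e''.
  apply: two_tf; rewrite lierD lierMn e'.
  have hD : t m.+1 m = lie (x q) (t m.+1 q) by rewrite lC // eqxx.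
  have hD' : lie (x q) (t m.+1 m) = 0 by rewrite lC // nmq.
  move: (serre_ad (t m.+1 q) Sqm).
  rewrite -hD hD' lie0r subr0 xC // nqm mulr0n sub0r !lierN !lierMn e lierB lierMn e' e''.
  rewrite -[q.+1]/m; set A := lie (x q) (lie (x m) _) => eA.
  have -> u : A + u + (A + u) = (A + A) + (u + u) by ncring.
  by rewrite -eA; case: (dl q); case: (dl m); rewrite ?mulr1n ?mulr0n ?oppr0 ?mul0rn ?mulr0n; ncring.
move=> i a b hi ha hb.
have [im|im] : ((0 < i < m) \/ i = m)%N by lia.
  have [am|->] : ((0 < a <= m) \/ a = m.+1)%N by lia.
    have [bm|->] : ((0 < b <= m) \/ b = m.+1)%N by lia.
      exact: IH.
    have -> : (m.+1 == i) = false by lia.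
    by rewrite mulr0n sub0r lB.
  have -> : (m.+1 == i.+1) = false by lia.
  rewrite mulr0n subr0.
  have [bm|->] : ((0 < b <= m) \/ b = m.+1)%N by lia.
    exact: lC.
  have -> : (m.+1 == i) = false by lia.
  by rewrite mulr0n xlD.
subst i.
have [am|->] : ((0 < a <= m) \/ a = m.+1)%N by lia.
  have -> : (a == m.+1) = false by lia.
  rewrite mulr0n subr0.
  have [bm|] : ((0 < b < m) \/ b = m \/ b = m.+1)%N by lia.
  - have -> : (b == m) = false by lia.
    by rewrite xA.
  - case=> ->; first by rewrite eqxx Bdef.
    have -> : (m.+1 == m) = false by lia.
    by rewrite xB.
rewrite eqxx /=.
have [bm|->] : ((0 < b <= m) \/ b = m.+1)%N by lia.
  exact: xC.
have -> : (m.+1 == m) = false by lia.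
by rewrite mulr0n sub0r xmD.
Qed.
End ColumnAction.

Definition row_act (L : pzRingType) (y : nat -> L) (t : nat -> nat -> L)
    (dl : nat -> bool) (m : nat) : Prop := forall i a b,
  (0 < i < m)%N -> (0 < a <= m)%N -> (0 < b <= m)%N ->
  lie (y i) (t a b) = t a i *+ ((b == i.+1) && dl i) - t i.+1 b *+ (a == i).

Lemma row_act_converse (L : pzRingType) (y : nat -> L) (t : nat -> nat -> L)
    (dl : nat -> bool) (m : nat) :
  row_act y t dl m <-> col_act (y : nat -> L^c) (fun a b => t b a) dl m.
Proof.
split=> h i a b hi ha hb.
  by rewrite lie_converse h // opprB.
by have := h i b a hi hb ha; rewrite lie_converse => /(canRL (@opprK L)) ->; rewrite opprB.
Qed.

(** * Covariance of the RTT defect and propagation of its vanishing *)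

Section RTTDefect.
Variables (A : pzRingType) (t : nat -> nat -> int -> A).

Definition rtt_defect (r s : int) (a b c d : nat) : A :=
  t a b (r + 1) * t c d s - t a b r * t c d (s + 1) + t c b r * t a d s
  - (t c d s * t a b (r + 1) - t c d (s + 1) * t a b r + t c b s * t a d r).

Lemma lie_rtt_defect_col (x : nat -> A) (dl : nat -> bool) (n : nat) r s i a b c d :
  (forall r, col_act x (fun a b => t a b r) dl n) ->
  (0 < i < n)%N -> (0 < a <= n)%N -> (0 < b <= n)%N ->
  (0 < c <= n)%N -> (0 < d <= n)%N ->
  lie (x i) (rtt_defect r s a b c d) =
    rtt_defect r s a i.+1 c d *+ (b == i) + rtt_defect r s a b c i.+1 *+ (d == i)
    - rtt_defect r s i b c d *+ ((a == i.+1) && dl i)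
    - rtt_defect r s a b i d *+ ((c == i.+1) && dl i).
Proof.
move=> X hi ha hb hc hd; rewrite /rtt_defect !(lierB, lierD, lierM).
rewrite !(X _ i a b) // !(X _ i c d) // !(X _ i c b) // !(X _ i a d) //.
case: (b == i); case: (d == i); case: (_ && _); case: (_ && _);
  rewrite ?mulr1n ?mulr0n; ncring.
Qed.

Lemma lie_rtt_defect_row (y : nat -> A) (dl : nat -> bool) (n : nat) r s i a b c d :
  (forall r, row_act y (fun a b => t a b r) dl n) ->
  (0 < i < n)%N -> (0 < a <= n)%N -> (0 < b <= n)%N ->
  (0 < c <= n)%N -> (0 < d <= n)%N ->
  lie (y i) (rtt_defect r s a b c d) =
    rtt_defect r s a i c d *+ ((b == i.+1) && dl i)
    + rtt_defect r s a b c i *+ ((d == i.+1) && dl i)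
    - rtt_defect r s i.+1 b c d *+ (a == i) - rtt_defect r s a b i.+1 d *+ (c == i).
Proof.
move=> Y hi ha hb hc hd; rewrite /rtt_defect !(lierB, lierD, lierM).
rewrite !(Y _ i a b) // !(Y _ i c d) // !(Y _ i c b) // !(Y _ i a d) //.
case: (a == i); case: (c == i); case: (_ && _); case: (_ && _);
  rewrite ?mulr1n ?mulr0n; ncring.
Qed.
End RTTDefect.

(** Stated for an abstract Q so that it serves columns and, after a transposition, rows. With b = d
    = m the relation for i = m gives only the sum of two unknown entries. So one index is raised
    from m to m+1 while the other is below m; the other then goes from q to m by i = q, and finally
    to m+1 by i = m. *)
Lemma column_extension (A : zmodType) (Q : nat -> nat -> nat -> nat -> A)
    (dl : nat -> bool) (M q : nat) (m := q.+1) : (0 < q)%N ->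
  (forall a b c d, (0 < a <= M)%N -> (0 < b <= m)%N -> (0 < c <= M)%N ->
     (0 < d <= m)%N -> Q a b c d = 0) ->
  (forall i a b c d, (i = q \/ i = m) -> (0 < a <= M)%N -> (0 < b <= m.+1)%N ->
     (0 < c <= M)%N -> (0 < d <= m.+1)%N -> Q a b c d = 0 ->
     Q a i.+1 c d *+ (b == i) + Q a b c i.+1 *+ (d == i)
     - Q i b c d *+ ((a == i.+1) && dl i) - Q a b i d *+ ((c == i.+1) && dl i) = 0) ->
  forall a b c d, (0 < a <= M)%N -> (0 < b <= m.+1)%N -> (0 < c <= M)%N ->
     (0 < d <= m.+1)%N -> Q a b c d = 0.
Proof.
move=> q0 Q0 act.
have nqm : (q == m) = false by rewrite /m; lia.
have nSm : (m.+1 == m) = false by lia.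
have nSq : (m.+1 == q) = false by rewrite /m; lia.
have m0 : (0 < m <= m)%N by rewrite /m; lia.
have q0m : (0 < q <= m)%N by rewrite /m; lia.
have up k : (0 < k <= m)%N -> (0 < k <= m.+1)%N by lia.
have act0 i a b c d : (i = q \/ i = m) -> (0 < a <= M)%N -> (0 < b <= m.+1)%N ->
    (0 < c <= M)%N -> (0 < d <= m.+1)%N -> Q a b c d = 0 ->
    (a = i.+1 -> Q i b c d = 0) -> (c = i.+1 -> Q a b i d = 0) ->
    Q a i.+1 c d *+ (b == i) + Q a b c i.+1 *+ (d == i) = 0.
  move=> hi ha hb hc hd h ea ec; rewrite -[RHS](act i a b c d) //.
  have -> : Q i b c d *+ ((a == i.+1) && dl i) = 0.
    by case: (a =P i.+1) => [/ea->|_]; rewrite ?mul0rn ?mulr0n.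
  have -> : Q a b i d *+ ((c == i.+1) && dl i) = 0.
    by case: (c =P i.+1) => [/ec->|_]; rewrite ?mul0rn ?mulr0n.
  by rewrite !subr0.
have S1r a b c : (0 < a <= M)%N -> (0 < b < m)%N -> (0 < c <= M)%N -> Q a b c m.+1 = 0.
  move=> ha hb hc; have hb' : (0 < b <= m)%N by lia.
  have := act0 m a b c m (or_intror erefl) ha (up _ hb') hc (up _ m0) (Q0 _ _ _ _ ha hb' hc m0).
  have -> : (b == m) = false by lia.
  by rewrite eqxx mulr0n mulr1n add0r; apply=> e; apply: Q0 => //; lia.
have S1l a c d : (0 < a <= M)%N -> (0 < d < m)%N -> (0 < c <= M)%N -> Q a m.+1 c d = 0.
  move=> ha hd hc; have hd' : (0 < d <= m)%N by lia.
  have := act0 m a m c d (or_intror erefl) ha (up _ m0) hc (up _ hd') (Q0 _ _ _ _ ha m0 hc hd').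
  have -> : (d == m) = false by lia.
  by rewrite eqxx mulr0n mulr1n addr0; apply=> e; apply: Q0 => //; lia.
have hm1 : (0 < m.+1 <= m.+1)%N by lia.
have hqm : (0 < q < m)%N by lia.
have S2r a c : (0 < a <= M)%N -> (0 < c <= M)%N -> Q a m c m.+1 = 0.
  move=> ha hc.
  have := act0 q a q c m.+1 (or_introl erefl) ha (up _ q0m) hc hm1 (S1r _ _ _ ha hqm hc).
  rewrite eqxx nSq mulr0n mulr1n addr0.
  by apply=> e; apply: S1r => //; lia.
have S2l a c : (0 < a <= M)%N -> (0 < c <= M)%N -> Q a m.+1 c m = 0.
  move=> ha hc.
  have := act0 q a m.+1 c q (or_introl erefl) ha hm1 hc (up _ q0m) (S1l _ _ _ ha hqm hc).
  rewrite eqxx nSq mulr0n mulr1n add0r.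
  by apply=> e; apply: S1l => //; lia.
have S3 a c : (0 < a <= M)%N -> (0 < c <= M)%N -> Q a m.+1 c m.+1 = 0.
  move=> ha hc.
  have := act0 m a m c m.+1 (or_intror erefl) ha (up _ m0) hc hm1 (S2r _ _ ha hc).
  rewrite eqxx nSm mulr0n mulr1n addr0.
  by apply=> e; apply: S2r => //; lia.
move=> a b c d ha hb hc hd.
have [hb'|->] : ((0 < b <= m) \/ b = m.+1)%N by lia.
  have [hd'|->] : ((0 < d <= m) \/ d = m.+1)%N by lia.
    exact: Q0.
  have [hb2|->] : ((0 < b < m) \/ b = m)%N by lia.
    exact: S1r.
  exact: S2r.
have [hd'|->] : ((0 < d <= m) \/ d = m.+1)%N by lia.
  have [hd2|->] : ((0 < d < m) \/ d = m)%N by lia.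
    exact: S1l.
  exact: S2l.
exact: S3.
Qed.

Lemma rtt_defect_step (A : pzRingType) (t : nat -> nat -> int -> A) (x y : nat -> A)
    (dl : nat -> bool) (q : nat) (m := q.+1) r s : (0 < q)%N ->
  (forall r, col_act x (fun a b => t a b r) dl m.+1) ->
  (forall r, row_act y (fun a b => t a b r) dl m.+1) ->
  (forall a b c d, (0 < a <= m)%N -> (0 < b <= m)%N -> (0 < c <= m)%N ->
     (0 < d <= m)%N -> rtt_defect t r s a b c d = 0) ->
  forall a b c d, (0 < a <= m.+1)%N -> (0 < b <= m.+1)%N -> (0 < c <= m.+1)%N ->
     (0 < d <= m.+1)%N -> rtt_defect t r s a b c d = 0.
Proof.
move=> q0 X Y Q0.
have Qcol a b c d : (0 < a <= m)%N -> (0 < b <= m.+1)%N -> (0 < c <= m)%N ->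
    (0 < d <= m.+1)%N -> rtt_defect t r s a b c d = 0.
  move: a b c d; apply: (column_extension (dl := dl)) => //.
  move=> i a b c d hi ha hb hc hd h.
  have hi' : (0 < i < m.+1)%N by lia.
  by rewrite -(lie_rtt_defect_col _ _ X hi') ?h ?lie0r //; lia.
move=> a b c d ha hb hc hd.
(* With all columns available, rows and columns change roles. The expression required is the
   negative of the one in [lie_rtt_defect_row]. *)
apply: (column_extension (Q := fun b a d c => rtt_defect t r s a b c d) (dl := dl)
  (M := m.+1) q0) => //; first by move=> *; apply: Qcol.
move=> {ha hb hc hd} {}i {}b {}a {}d {}c hi ha hb hc hd h; apply/eqP; rewrite -oppr_eq0; apply/eqP.
transitivity (lie (y i) (rtt_defect t r s a b c d)); last by rewrite h lie0r.
have hi' : (0 < i < m.+1)%N by lia.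
rewrite (lie_rtt_defect_row _ _ Y hi') //.
by rewrite !opprB opprD; ncring.
Qed.

(** * Formal power series *)

Record pser (A : pzRingType) := Pser { pcoef : nat -> A }.
Arguments Pser {A}.

Lemma pserP (A : pzRingType) (p q : pser A) : pcoef p =1 pcoef q -> p = q.
Proof. by case: p q => p [q] /= /funext ->. Qed.

HB.instance Definition _ (A : pzRingType) := gen_eqMixin (pser A).
HB.instance Definition _ (A : pzRingType) := gen_choiceMixin (pser A).

Section PowerSeries.
Variable A : pzRingType.
Implicit Types p q r : pser A.

Definition pser0 : pser A := Pser (fun=> 0).
Definition pser1 : pser A := Pser (fun n => if n == 0%N then 1 else 0).
Definition pser_opp p := Pser (fun n => - pcoef p n).
Definition pser_add p q := Pser (fun n => pcoef p n + pcoef q n).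
Definition pser_mul p q :=
  Pser (fun n => \sum_(i < n.+1) pcoef p i * pcoef q (n - i)%N).

Fact pser_addA : associative pser_add.
Proof. by move=> p q r; apply: pserP => n /=; rewrite addrA. Qed.
Fact pser_addC : commutative pser_add.
Proof. by move=> p q; apply: pserP => n /=; rewrite addrC. Qed.
Fact pser_add0 : left_id pser0 pser_add.
Proof. by move=> p; apply: pserP => n /=; rewrite add0r. Qed.
Fact pser_addN : left_inverse pser0 pser_opp pser_add.
Proof. by move=> p; apply: pserP => n /=; rewrite addNr. Qed.

HB.instance Definition _ :=
  GRing.isZmodule.Build (pser A) pser_addA pser_addC pser_add0 pser_addN.

Fact pser_mulA : associative pser_mul.
Proof.
move=> p q r; apply: pserP => n /=.
under eq_bigr => i _ do rewrite mulr_sumr.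
under [RHS]eq_bigr => i _ do rewrite mulr_suml.
pose G i j := pcoef p i * (pcoef q j * pcoef r (n - i - j)%N).
transitivity (\sum_(i < n.+1) \sum_(k < n.+1 | (i <= k)%N) G i (k - i)%N).
  apply: eq_bigr => i _.
  rewrite -(big_geq_mkord i n.+1 xpredT (fun k => G i (k - i)%N)).
  rewrite -[X in \sum_(X <= _ < _) _]add0n big_addn big_mkord subSn -1?ltnS //.
  by apply: eq_bigr => k _; rewrite addnK.
rewrite (exchange_big_dep predT) //=; apply: eq_bigr => k _.
rewrite (big_ord_widen n.+1 (fun i => pcoef p i * pcoef q (k - i)%N * pcoef r (n - k)%N)) //.
apply: eq_big => [i|i ik]; first by rewrite ltnS.
by rewrite /G mulrA -subnDA subnKC.
Qed.
Fact pser_mul1l : left_id pser1 pser_mul.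
Proof.
move=> p; apply: pserP => n /=; rewrite big_ord_recl mul1r subn0 big1 ?addr0 //.
by move=> i _; rewrite mul0r.
Qed.
Fact pser_mul1r : right_id pser1 pser_mul.
Proof.
move=> p; apply: pserP => n /=; rewrite big_ord_recr /= subnn mulr1 big1 ?add0r //.
by move=> i _; rewrite subn_eq0 leqNgt ltn_ord mulr0.
Qed.
Fact pser_mulDl : left_distributive pser_mul pser_add.
Proof.
move=> p q r; apply: pserP => n /=; rewrite -big_split; apply: eq_bigr => i _.
exact: mulrDl.
Qed.
Fact pser_mulDr : right_distributive pser_mul pser_add.
Proof.
move=> p q r; apply: pserP => n /=; rewrite -big_split; apply: eq_bigr => i _.
exact: mulrDr.
Qed.

HB.instance Definition _ := GRing.Zmodule_isPzRing.Build (pser A)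
  pser_mulA pser_mul1l pser_mul1r pser_mulDl pser_mulDr.

Lemma pcoef1 n : pcoef (1 : pser A) n = if n == 0%N then 1 else 0. Proof. by []. Qed.
Lemma pcoefD p q n : pcoef (p + q) n = pcoef p n + pcoef q n. Proof. by []. Qed.
Lemma pcoefN p n : pcoef (- p) n = - pcoef p n. Proof. by []. Qed.
Lemma pcoefB p q n : pcoef (p - q) n = pcoef p n - pcoef q n. Proof. by []. Qed.
Lemma pcoefM p q n : pcoef (p * q) n = \sum_(i < n.+1) pcoef p i * pcoef q (n - i)%N.
Proof. by []. Qed.
Lemma pcoef_sum (I : Type) (s : seq I) (P : pred I) (F : I -> pser A) n :
  pcoef (\sum_(i <- s | P i) F i) n = \sum_(i <- s | P i) pcoef (F i) n.
Proof. by elim/big_rec2: _ => //= i y1 y2 _ <-. Qed.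
Lemma pcoefMn p k n : pcoef (p *+ k) n = pcoef p n *+ k.
Proof. by elim: k => [|k IH]; rewrite ?mulr0n // !mulrS pcoefD IH. Qed.

Definition pserC (a : A) : pser A := Pser (fun n => if n == 0%N then a else 0).
Definition pserX : pser A := Pser (fun n => if n == 1%N then 1 else 0).

Lemma pserC0 : pserC 0 = 0.
Proof. by apply: pserP => n /=; case: eqP. Qed.
Lemma pserC1 : pserC 1 = 1. Proof. by []. Qed.
Lemma pserCN a : pserC (- a) = - pserC a.
Proof. by apply: pserP => n /=; case: eqP => _ //; rewrite oppr0. Qed.
Lemma pserCB a b : pserC (a - b) = pserC a - pserC b.
Proof. by apply: pserP => n /=; case: eqP => _ //; rewrite subr0. Qed.
Lemma pcoefCM a p n : pcoef (pserC a * p) n = a * pcoef p n.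
Proof. by rewrite pcoefM big_ord_recl /= subn0 big1 ?addr0 // => i _; rewrite mul0r. Qed.
Lemma pcoefMC a p n : pcoef (p * pserC a) n = pcoef p n * a.
Proof.
rewrite pcoefM big_ord_recr /= subnn big1 ?add0r // => i _.
by rewrite subn_eq0 leqNgt ltn_ord mulr0.
Qed.
Lemma pserCM a b : pserC (a * b) = pserC a * pserC b.
Proof. by apply: pserP => n; rewrite pcoefCM /=; case: eqP => _ //; rewrite mulr0. Qed.
Lemma pserC_lie a b : pserC (lie a b) = lie (pserC a) (pserC b).
Proof. by rewrite !lieE pserCB !pserCM. Qed.
Lemma pcoef_lieC a p n : pcoef (lie (pserC a) p) n = lie a (pcoef p n).
Proof. by rewrite !lieE pcoefB pcoefCM pcoefMC. Qed.

Lemma pcoefXM p n : pcoef (pserX * p) n = if n is k.+1 then pcoef p k else 0.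
Proof.
rewrite pcoefM; case: n => [|n].
  by rewrite big_ord1 /= mul0r.
rewrite big_ord_recl /= mul0r add0r big_ord_recl /= mul1r subSS subn0.
by rewrite big1 ?addr0 // => i _; rewrite mul0r.
Qed.
Lemma pcoefMX p n : pcoef (p * pserX) n = if n is k.+1 then pcoef p k else 0.
Proof.
rewrite pcoefM; case: n => [|n].
  by rewrite big_ord1 /= mulr0.
rewrite big_ord_recr /= subnn mulr0 addr0 big_ord_recr /= subSn // subnn mulr1.
rewrite big1 ?add0r // => i _; rewrite (_ : (_ == _) = false) ?mulr0 //.
by have := ltn_ord i; lia.
Qed.
Lemma pserX_comm p : pserX * p = p * pserX.
Proof. by apply: pserP => n; rewrite pcoefXM pcoefMX. Qed.
Lemma pserXI p : pserX * p = 0 -> p = 0.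
Proof. by move=> h; apply: pserP => n; have := pcoefXM p n.+1; rewrite h. Qed.

Lemma pcoefXnM k p n :
  pcoef (pserX ^+ k * p) n = if (k <= n)%N then pcoef p (n - k)%N else 0.
Proof.
elim: k n => [|k IH] n; first by rewrite expr0 mul1r subn0.
by rewrite exprS -mulrA pcoefXM; case: n => // n; rewrite IH.
Qed.

(** The lowest term is v^N with coefficient 1. After the common shift by c_1 the series g_k begins
    in degree c_1 - c_k, so it need not be invertible, but it can still be cancelled on either
    side. *)
Definition monic_at (N : nat) p : Prop :=
  pcoef p N = 1 /\ forall k, (k < N)%N -> pcoef p k = 0.

Lemma monic_at_lreg N p q : monic_at N p -> p * q = 0 -> q = 0.
Proof.
move=> [p1 p0] pq0; apply: pserP; elim/ltn_ind => n IH.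
have := congr1 (fun s => pcoef s (N + n)) pq0; rewrite /= => <-.
have hN : (N < (N + n).+1)%N by rewrite ltnS leq_addr.
rewrite (bigD1 (Ordinal hN)) //= p1 mul1r addKn big1 ?addr0 // => i /eqP hi.
have {hi} : nat_of_ord i <> N by move=> e; apply: hi; apply: val_inj.
case: (ltnP i N) => [lt _|le ne]; first by rewrite p0 ?mul0r.
by rewrite IH ?mulr0 //; have := ltn_ord i; lia.
Qed.
Lemma monic_at_rreg N p q : monic_at N p -> q * p = 0 -> q = 0.
Proof.
move=> [p1 p0] qp0; apply: pserP; elim/ltn_ind => n IH.
have := congr1 (fun s => pcoef s (n + N)) qp0; rewrite /= => <-.
have hn : (n < (n + N).+1)%N by rewrite ltnS leq_addr.
rewrite (bigD1 (Ordinal hn)) //= addKn p1 mulr1 big1 ?addr0 // => i /eqP hi.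
have {hi} : nat_of_ord i <> n by move=> e; apply: hi; apply: val_inj.
case: (ltnP i n) => [lt _|le ne]; first by rewrite IH ?mul0r.
by rewrite p0 ?mulr0 //; have := ltn_ord i; lia.
Qed.
End PowerSeries.
Arguments pserX {A}.

(** * Gauss coordinates *)

Section GaussCoordinates.
Variables (L : pzRingType) (x y g E F : nat -> L) (dl : nat -> bool).

Fixpoint gauss_e (k j : nat) : L :=
  if j is i.+1 then
    if k == i.+1 then 1 else if k == i then E i else lie (x i) (gauss_e k i)
  else 0.

Fixpoint gauss_f (j k : nat) : L :=
  if j is i.+1 then
    if k == i.+1 then 1 else if k == i then F i else - lie (y i) (gauss_f i k)
  else 0.

Definition gauss_t (a b : nat) : L :=
  \sum_(1 <= k < (minn a b).+1) gauss_f a k * g k * gauss_e k b.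

(* The part of the Drinfeld relations that the argument needs: x i and y i are the
   constants E_i^(1) and F_i^(1), and dl i says that c_i = c_{i+1}. *)
Record gauss_rels (n : nat) : Prop := GaussRels {
  gr_xx : forall i j, (0 < i)%N -> (i.+1 < j < n)%N -> lie (x i) (x j) = 0;
  gr_yy : forall i j, (0 < i)%N -> (i.+1 < j < n)%N -> lie (y i) (y j) = 0;
  gr_xy : forall i j, (0 < i < n)%N -> (0 < j < n)%N -> i <> j -> lie (x i) (y j) = 0;
  gr_xxx : forall i, (0 < i)%N -> (i.+1 < n)%N -> lie (x i) (lie (x i) (x i.+1)) = 0;
  gr_xxx' : forall i, (0 < i)%N -> (i.+1 < n)%N -> lie (x i.+1) (lie (x i.+1) (x i)) = 0;
  gr_yyy : forall i, (0 < i)%N -> (i.+1 < n)%N -> lie (y i) (lie (y i) (y i.+1)) = 0;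
  gr_yyy' : forall i, (0 < i)%N -> (i.+1 < n)%N -> lie (y i.+1) (lie (y i.+1) (y i)) = 0;
  gr_xE : forall i j, (0 < i)%N -> (i.+1 < j < n)%N -> lie (x j) (E i) = 0;
  gr_yF : forall i j, (0 < i)%N -> (i.+1 < j < n)%N -> lie (y j) (F i) = 0;
  gr_xF : forall i j, (0 < i < j)%N -> (j < n)%N -> lie (x j) (F i) = 0;
  gr_yE : forall i j, (0 < i < j)%N -> (j < n)%N -> lie (y j) (E i) = 0;
  gr_xg0 : forall i j, (0 < i < j)%N -> (j < n)%N -> lie (x j) (g i) = 0;
  gr_yg0 : forall i j, (0 < i < j)%N -> (j < n)%N -> lie (y j) (g i) = 0;
  gr_xg : forall i, (0 < i < n)%N -> lie (x i) (g i) = g i * E i;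
  gr_yg : forall i, (0 < i < n)%N -> lie (y i) (g i) = - (F i * g i);
  gr_xFg : forall i, (0 < i < n)%N -> lie (x i) (F i) * g i = g i.+1 - g i *+ dl i;
  gr_kg : forall i j, (0 < i <= j)%N -> (j < n)%N -> lie (lie (x j) (y j)) (g i) = 0;
  gr_kE0 : forall i j, (0 < i)%N -> (i.+1 < j < n)%N -> lie (lie (x j) (y j)) (E i) = 0;
  gr_kF0 : forall i j, (0 < i)%N -> (i.+1 < j < n)%N -> lie (lie (x j) (y j)) (F i) = 0;
  gr_kE : forall i, (0 < i)%N -> (i.+1 < n)%N ->
    lie (lie (x i.+1) (y i.+1)) (E i) = - (E i *+ dl i.+1);
  gr_kF : forall i, (0 < i)%N -> (i.+1 < n)%N ->
    lie (lie (x i.+1) (y i.+1)) (F i) = F i *+ dl i.+1;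
  gr_kx0 : forall i j, (0 < i)%N -> (i.+1 < j < n)%N -> lie (lie (x j) (y j)) (x i) = 0;
  gr_ky0 : forall i j, (0 < i)%N -> (i.+1 < j < n)%N -> lie (lie (x j) (y j)) (y i) = 0;
  gr_kx : forall i, (0 < i)%N -> (i.+1 < n)%N ->
    lie (lie (x i.+1) (y i.+1)) (x i) = - (x i *+ dl i.+1);
  gr_ky : forall i, (0 < i)%N -> (i.+1 < n)%N ->
    lie (lie (x i.+1) (y i.+1)) (y i) = y i *+ dl i.+1;
  gr_kE1 : lie (lie (x 1%N) (y 1%N)) (E 1%N) = E 1%N *+ dl 1%N + E 1%N *+ dl 1%N;
  gr_kF1 : lie (lie (x 1%N) (y 1%N)) (F 1%N) = - (F 1%N *+ dl 1%N + F 1%N *+ dl 1%N);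
  gr_xE1 : lie (x 1%N) (E 1%N) = - (E 1%N * E 1%N);
  gr_yF1 : lie (y 1%N) (F 1%N) = F 1%N * F 1%N
}.

Variable n : nat.
Hypothesis H : gauss_rels n.

Lemma gauss_e_gt k j : (j < k)%N -> gauss_e k j = 0.
Proof.
elim: j => //= j IH jk; have [-> ->] : (k == j.+1) = false /\ (k == j) = false by lia.
by rewrite IH ?lie0r //; lia.
Qed.
Lemma gauss_f_gt k j : (j < k)%N -> gauss_f j k = 0.
Proof.
elim: j => //= j IH jk; have [-> ->] : (k == j.+1) = false /\ (k == j) = false by lia.
by rewrite IH ?lie0r ?oppr0 //; lia.
Qed.
Lemma gauss_e_diag k : (0 < k)%N -> gauss_e k k = 1.
Proof. by case: k => //= k; rewrite eqxx. Qed.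
Lemma gauss_f_diag k : (0 < k)%N -> gauss_f k k = 1.
Proof. by case: k => //= k; rewrite eqxx. Qed.
Lemma gauss_e_simple k : gauss_e k k.+1 = E k.
Proof. by rewrite /= eqxx ltn_eqF. Qed.
Lemma gauss_f_simple k : gauss_f k.+1 k = F k.
Proof. by rewrite /= eqxx ltn_eqF. Qed.
Lemma gauss_eS k j : (k < j)%N -> gauss_e k j.+1 = lie (x j) (gauss_e k j).
Proof. by move=> h; rewrite /= !ltn_eqF // ltnW. Qed.
Lemma gauss_fS k j : (k < j)%N -> gauss_f j.+1 k = - lie (y j) (gauss_f j k).
Proof. by move=> h; rewrite /= !ltn_eqF // ltnW. Qed.

Arguments gauss_e : simpl never.
Arguments gauss_f : simpl never.

(** [gauss_e k b] is 0, 1 or an iterated bracket of one [E i] with several [x i], all of index below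
    b. *)
Lemma lie_gauss_e0 z k b : (0 < k)%N ->
  (forall i, (0 < i < b)%N -> lie z (x i) = 0) ->
  (forall i, (0 < i < b)%N -> lie z (E i) = 0) -> lie z (gauss_e k b) = 0.
Proof.
move=> k0; elim: b => [|b IH] hx hE; first by rewrite lie0r.
case: (ltngtP k b) => [lt|gt|e].
- rewrite gauss_eS // lie0_lie //; first by apply: hx; lia.
  by apply: IH => i hi; [apply: hx|apply: hE]; lia.
- have [->|ne] := eqVneq k b.+1; first by rewrite gauss_e_diag //; ncring.
  by rewrite gauss_e_gt ?lie0r //; lia.
- by rewrite -e gauss_e_simple hE //; lia.
Qed.
Lemma lie_gauss_f0 z k b : (0 < k)%N ->
  (forall i, (0 < i < b)%N -> lie z (y i) = 0) ->
  (forall i, (0 < i < b)%N -> lie z (F i) = 0) -> lie z (gauss_f b k) = 0.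
Proof.
move=> k0; elim: b => [|b IH] hx hE; first by rewrite lie0r.
case: (ltngtP k b) => [lt|gt|e].
- rewrite gauss_fS // lierN lie0_lie ?oppr0 //; first by apply: hx; lia.
  by apply: IH => i hi; [apply: hx|apply: hE]; lia.
- have [->|ne] := eqVneq k b.+1; first by rewrite gauss_f_diag //; ncring.
  by rewrite gauss_f_gt ?lie0r //; lia.
- by rewrite -e gauss_f_simple hE //; lia.
Qed.

Lemma lie_x_e m k b : (0 < k)%N -> (b < m < n)%N -> lie (x m) (gauss_e k b) = 0.
Proof.
move=> k0 hm; apply: lie_gauss_e0 => // i hi; last by apply: (gr_xE H); lia.
by apply: lie_swap0; apply: (gr_xx H); lia.
Qed.
Lemma lie_y_e m k b : (0 < k)%N -> (b <= m < n)%N -> lie (y m) (gauss_e k b) = 0.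
Proof.
move=> k0 hm; apply: lie_gauss_e0 => // i hi; last by apply: (gr_yE H); lia.
by apply: lie_swap0; apply: (gr_xy H); lia.
Qed.
Lemma lie_y_f m k b : (0 < k)%N -> (b < m < n)%N -> lie (y m) (gauss_f b k) = 0.
Proof.
move=> k0 hm; apply: lie_gauss_f0 => // i hi; last by apply: (gr_yF H); lia.
by apply: lie_swap0; apply: (gr_yy H); lia.
Qed.
Lemma lie_x_f m k b : (0 < k)%N -> (b <= m < n)%N -> lie (x m) (gauss_f b k) = 0.
Proof.
move=> k0 hm; apply: lie_gauss_f0 => // i hi; last by apply: (gr_xF H); lia.
by apply: (gr_xy H); lia.
Qed.
Lemma lie_k_e0 m k b : (0 < k)%N -> (b < m < n)%N ->
  lie (lie (x m) (y m)) (gauss_e k b) = 0.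
Proof.
move=> k0 hm; apply: lie_gauss_e0 => // i hi; last by apply: (gr_kE0 H); lia.
by apply: (gr_kx0 H); lia.
Qed.
Lemma lie_k_f0 m k b : (0 < k)%N -> (b < m < n)%N ->
  lie (lie (x m) (y m)) (gauss_f b k) = 0.
Proof.
move=> k0 hm; apply: lie_gauss_f0 => // i hi; last by apply: (gr_kF0 H); lia.
by apply: (gr_ky0 H); lia.
Qed.
(** Of the factors of [gauss_e k m], only the one of index m - 1 has nonzero weight under
    [x_m, y_m]. It occurs once: as the outermost x, or as E itself when k = m - 1. *)
Lemma lie_k_e m k : (0 < k < m)%N -> (m < n)%N ->
  lie (lie (x m) (y m)) (gauss_e k m) = - (gauss_e k m *+ dl m).
Proof.
case: m => [|m] hk hm; first by rewrite ltn0 andbF in hk.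
have [lt|e] : ((k < m) \/ k = m)%N by lia.
  rewrite gauss_eS // lie_jacobi (gr_kx H) ?lie_k_e0 ?lie0r ?addr0; try natlia.
  by case: (dl _); rewrite ?mulr1n ?mulr0n; ncring.
by rewrite -e gauss_e_simple (gr_kE H) //; lia.
Qed.
Lemma lie_k_f m k : (0 < k < m)%N -> (m < n)%N ->
  lie (lie (x m) (y m)) (gauss_f m k) = gauss_f m k *+ dl m.
Proof.
case: m => [|m] hk hm; first by rewrite ltn0 andbF in hk.
have [lt|e] : ((k < m) \/ k = m)%N by lia.
  rewrite gauss_fS // lierN lie_jacobi (gr_ky H) ?lie_k_f0 ?lie0r ?addr0; try natlia.
  by case: (dl _); rewrite ?mulr1n ?mulr0n; ncring.
by rewrite -e gauss_f_simple (gr_kF H) //; lia.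
Qed.

Lemma lie_x_t0 m a b : (m < n)%N -> (0 < a <= m)%N -> (0 < b < m)%N ->
  lie (x m) (gauss_t a b) = 0.
Proof.
move=> mn ha hb; rewrite lier_sum big1_seq // => k /andP[_]; rewrite mem_index_iota => hk.
by rewrite !lie0M ?lie_x_f ?lie_x_e ?(gr_xg0 H) //; lia.
Qed.
Lemma lie_y_t0 m a b : (m < n)%N -> (0 < a < m)%N -> (0 < b <= m)%N ->
  lie (y m) (gauss_t a b) = 0.
Proof.
move=> mn ha hb; rewrite lier_sum big1_seq // => k /andP[_]; rewrite mem_index_iota => hk.
by rewrite !lie0M ?lie_y_f ?lie_y_e ?(gr_yg0 H) //; lia.
Qed.
(** For k < m only the factor e_{km} is moved, and to e_{k,m+1} by construction. For k = m the new
    factor comes from [x_m, g_m] = g_m E_m. *)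
Lemma lie_x_t m a : (m < n)%N -> (0 < a <= m)%N ->
  lie (x m) (gauss_t a m) = gauss_t a m.+1.
Proof.
move=> mn ha; have [e1 e2] : minn a m = a /\ minn a m.+1 = a by lia.
rewrite /gauss_t e1 e2 lier_sum; apply: eq_big_nat => k hk.
rewrite !lierM lie_x_f; try natlia.
have [lt|->] : ((k < m) \/ k = m)%N by lia.
  rewrite (gr_xg0 H) ?gauss_eS; try natlia.
  by ncring.
rewrite (gr_xg H) ?gauss_e_diag ?gauss_e_simple; try natlia.
by ncring.
Qed.
Lemma lie_y_t m b : (m < n)%N -> (0 < b <= m)%N ->
  lie (y m) (gauss_t m b) = - gauss_t m.+1 b.
Proof.
move=> mn hb; have [e1 e2] : minn m b = b /\ minn m.+1 b = b by lia.
rewrite /gauss_t e1 e2 lier_sum -sumrN; apply: eq_big_nat => k hk.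
rewrite !lierM lie_y_e; try natlia.
have [lt|->] : ((k < m) \/ k = m)%N by lia.
  rewrite (gr_yg0 H) ?gauss_fS; try natlia.
  by ncring.
rewrite (gr_yg H) ?gauss_f_diag ?gauss_f_simple; try natlia.
by ncring.
Qed.
Lemma gauss_t_diag m : (0 < m)%N ->
  gauss_t m m = \sum_(1 <= k < m) gauss_f m k * g k * gauss_e k m + g m.
Proof.
move=> m0; rewrite /gauss_t minnn big_nat_recr //= gauss_e_diag // gauss_f_diag //.
by rewrite mul1r mulr1.
Qed.
(** For k < m, moving x_m past f_{m+1,k} = - [y_m, f_{mk}] leaves - [[x_m, y_m], f_{mk}], which is
    the multiple of f_{mk} in the correction. The term k = m supplies g_{m+1} through [gr_xFg]. *)
Lemma lie_x_tdiag m : (0 < m < n)%N ->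
  lie (x m) (gauss_t m.+1 m) = gauss_t m.+1 m.+1 - gauss_t m m *+ dl m.
Proof.
move=> hm; rewrite gauss_t_diag // gauss_t_diag; last by lia.
rewrite /gauss_t (_ : minn m.+1 m = m); last by lia.
rewrite !big_nat_recr /=; try natlia.
rewrite gauss_e_diag ?gauss_f_simple ?gauss_e_simple; try natlia.
rewrite mulr1 lierD lierM (gr_xFg H) // (gr_xg H) // mulrnDl -sumrMnl lier_sum.
have -> : \sum_(1 <= k < m) lie (x m) (gauss_f m.+1 k * g k * gauss_e k m) =
  \sum_(1 <= k < m) gauss_f m.+1 k * g k * gauss_e k m.+1
  - \sum_(1 <= k < m) (gauss_f m k * g k * gauss_e k m) *+ dl m.
  rewrite -sumrB; apply: eq_big_nat => k hk.
  rewrite !lierM (gr_xg0 H) ?gauss_eS; try natlia.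
  rewrite gauss_fS; last by lia.
  rewrite lierN lie_jacobi.
  rewrite lie_k_f; try natlia.
  rewrite lie_x_f; try natlia.
  rewrite lie0r.
  by case: (dl m); rewrite ?mulr1n ?mulr0n; ncring.
by ncring.
Qed.
(** A count of weights under [x_m, y_m]: f_{mk} has weight [dl m], e_{km} the opposite weight, and
    the other factors weight 0. On the diagonal the two cancel. *)
Lemma lie_k_t_row m b : (m < n)%N -> (0 < b <= m)%N ->
  lie (lie (x m) (y m)) (gauss_t m b) = gauss_t m b *+ ((b < m)%N && dl m).
Proof.
move=> mn hb; have [lt|e] : ((b < m) \/ b = m)%N by lia.
  rewrite lt /= /gauss_t -sumrMnl lier_sum; apply: eq_big_nat => k hk.
  rewrite !lierM lie_k_f ?lie_k_e0 ?(gr_kg H) //; try natlia.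
  by rewrite !mulr0 !addr0 !mulrnAl.
rewrite e ltnn mulr0n gauss_t_diag ?lierD ?lier_sum; last by lia.
rewrite (gr_kg H) ?addr0; try natlia.
rewrite big1_seq // => k /andP[_]; rewrite mem_index_iota => hk.
rewrite !lierM lie_k_f ?lie_k_e ?(gr_kg H) //; try natlia.
by case: (dl m); rewrite ?mulr1n ?mulr0n; ncring.
Qed.
Lemma lie_k_t_col m b : (m < n)%N -> (0 < b <= m)%N ->
  lie (lie (x m) (y m)) (gauss_t b m) = - (gauss_t b m *+ ((b < m)%N && dl m)).
Proof.
move=> mn hb; have [lt|e] : ((b < m) \/ b = m)%N by lia.
  rewrite lt /= /gauss_t -sumrMnl lier_sum -sumrN; apply: eq_big_nat => k hk.
  rewrite !lierM lie_k_f0 ?lie_k_e ?(gr_kg H) //; try natlia.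
  by case: (dl m); rewrite ?mulr1n ?mulr0n; ncring.
by rewrite e lie_k_t_row ?ltnn ?mulr0n ?oppr0 //; lia.
Qed.
(** [y_m, [x_m, t_{mm}]] and [x_m, [y_m, t_{mm}]] differ by the bracket of [x_m, y_m] with t_{mm},
    which is zero. *)
Lemma lie_y_tdiag m : (0 < m < n)%N ->
  lie (y m) (gauss_t m m.+1) = - (gauss_t m.+1 m.+1 - gauss_t m m *+ dl m).
Proof.
move=> hm; rewrite -lie_x_tdiag // -lie_x_t; try natlia.
rewrite -[gauss_t m.+1 m]opprK -lie_y_t; try natlia.
rewrite lierN opprK [RHS]lie_jacobi lie_k_t_row ?ltnn ?mulr0n ?add0r //; lia.
Qed.

Hypothesis two_tf : forall z : L, z + z = 0 -> z = 0.

(** At the start there is no neighbour x_q and hence no Serre relation; its place is taken by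
    [x_1, E_1] = - E_1^2 and the weight 2 of E_1 under [x_1, y_1]. *)
Lemma gauss_col_act2 : (1 < n)%N -> col_act x gauss_t dl 2.
Proof.
move=> n2 i a b hi ha hb; have -> : i = 1%N by lia.
have t11 : gauss_t 1 1 = g 1%N by rewrite gauss_t_diag // big_geq // add0r.
have t12 : gauss_t 1 2 = g 1%N * E 1%N by rewrite /gauss_t big_nat1 /= mul1r.
have x12 : lie (x 1%N) (gauss_t 1 2) = 0.
  by rewrite t12 lierM (gr_xg H) ?(gr_xE1 H) //; ncring.
have x22 : lie (x 1%N) (gauss_t 2 2) = - (gauss_t 1 2 *+ dl 1).
  have -> : gauss_t 2 2 = - lie (y 1%N) (gauss_t 1 2) + gauss_t 1 1 *+ dl 1.
    by rewrite lie_y_tdiag // opprK subrK.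
  rewrite lierD lierMn lie_x_t // lierN lie_jacobi x12 lie0r addr0 t12.
  rewrite lierM (gr_kg H) // (gr_kE1 H).
  by case: (dl 1); rewrite ?mulr1n ?mulr0n; ncring.
have [->|->] : (a = 1 \/ a = 2)%N by lia.
  have [->|->] : (b = 1 \/ b = 2)%N by lia.
    by rewrite lie_x_t // subr0.
  by rewrite x12 subr0.
have [->|->] : (b = 1 \/ b = 2)%N by lia.
  by rewrite lie_x_tdiag.
by rewrite x22 sub0r.
Qed.
Lemma gauss_row_act2 : (1 < n)%N -> row_act y gauss_t dl 2.
Proof.
move=> n2 i a b hi ha hb; have -> : i = 1%N by lia.
have t21 : gauss_t 2 1 = F 1%N * g 1%N by rewrite /gauss_t big_nat1 /= mulr1.
have y21 : lie (y 1%N) (gauss_t 2 1) = 0.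
  by rewrite t21 lierM (gr_yg H) ?(gr_yF1 H) //; ncring.
have y22 : lie (y 1%N) (gauss_t 2 2) = gauss_t 2 1 *+ dl 1.
  have -> : gauss_t 2 2 = lie (x 1%N) (gauss_t 2 1) + gauss_t 1 1 *+ dl 1.
    by rewrite lie_x_tdiag // subrK.
  rewrite lierD lierMn lie_y_t // lie_jacobi y21 lie0r addr0 t21.
  rewrite (lieC (y 1%N) (x 1%N)).
  have -> u v : lie (- u) v = - lie u v :> L by ncring.
  rewrite lierM (gr_kg H) // (gr_kF1 H).
  by case: (dl 1); rewrite ?mulr1n ?mulr0n; ncring.
have [->|->] : (a = 1 \/ a = 2)%N by lia.
  have [->|->] : (b = 1 \/ b = 2)%N by lia.
    by rewrite lie_y_t // sub0r.
  by rewrite lie_y_tdiag // opprB.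
have [->|->] : (b = 1 \/ b = 2)%N by lia.
  by rewrite y21 subr0.
by rewrite y22 subr0.
Qed.

Lemma gauss_col_act m : (1 < m <= n)%N -> col_act x gauss_t dl m.
Proof.
elim: m => // -[//|q] IH hm; have [->|q0] := posnP q; first by apply: gauss_col_act2; lia.
apply: (col_act_step two_tf (y := y) q0) => //.
- by apply: IH; lia.
- by apply: (gr_xxx' H); lia.
- by apply: (gr_xxx H); lia.
- by move=> i hi; apply: (gr_xx H); lia.
- by move=> i hi; apply: (gr_xy H); lia.
- by move=> a b ha hb; apply: lie_x_t0; lia.
- by move=> a b ha hb; apply: lie_y_t0; lia.
- by move=> a ha; apply: lie_x_t; lia.
- by move=> b hb; apply: lie_y_t; lia.
- by apply: lie_x_tdiag; lia.
- by move=> b hb; apply: lie_k_t_row; lia.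
Qed.
Lemma gauss_row_act m : (1 < m <= n)%N -> row_act y gauss_t dl m.
Proof.
elim: m => // -[//|q] IH hm; have [->|q0] := posnP q; first by apply: gauss_row_act2; lia.
apply/row_act_converse.
apply: (@col_act_step L^c _ _ _ two_tf (x : nat -> L^c) q q0) => //.
- by apply/row_act_converse/IH; lia.
- by rewrite !lie_converse lierN (gr_yyy' H) ?oppr0 //; lia.
- by rewrite !lie_converse lierN (gr_yyy H) ?oppr0 //; lia.
- by move=> i hi; rewrite lie_converse (gr_yy H) ?oppr0 //; lia.
- by move=> i hi; rewrite lie_converse lie_swap0 ?oppr0 //; apply: (gr_xy H); lia.
- by move=> a b ha hb; rewrite lie_converse lie_y_t0 ?oppr0 //; lia.
- by move=> a b ha hb; rewrite lie_converse lie_x_t0 ?oppr0 //; lia.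
- by move=> a ha; rewrite lie_converse lie_y_t ?opprK //; lia.
- by move=> b hb; rewrite lie_converse lie_x_t //; lia.
- by rewrite lie_converse lie_y_tdiag ?opprK //; lia.
- move=> b hb; rewrite !lie_converse -(lieC (x q.+1)) lie_k_t_col ?opprK //; lia.
Qed.
End GaussCoordinates.

(** * Coefficients and series *)

Section FiniteSums.
Variable A : pzRingType.
Implicit Types (h X Y : int -> A) (lo hi p q r : int).

(** Brings integer ranges to one ordinal range, where convolutions can be compared. The vanishing
    hypothesis also covers the empty range hi < lo. *)
Lemma isum_widen lo hi p (N : nat) h : p <= lo -> hi < p + N%:Z ->
  (forall k, k < lo \/ hi < k -> h k = 0) ->
  isum lo hi h = \sum_(i < N) h (p + i%:Z).
Proof.
move=> plo hiN h0; rewrite /isum; case: ifPn => [lohi|nlohi]; last first.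
  by rewrite big1 // => i _; apply: h0; lia.
rewrite -(big_mkord xpredT (fun i => h (p + i%:Z))) -(big_mkord xpredT (fun k => h (lo + k%:Z))).
have [u [v [eu ev]]] : exists u v : nat, lo = p + u%:Z /\ hi = lo + v%:Z.
  by exists (absz (lo - p)), (absz (hi - lo)); split; lia.
have -> : `|hi - lo|%N = v by lia.
rewrite (@big_cat_nat _ _ _ u 0 N) //=; last by lia.
rewrite (@big_cat_nat _ _ _ (u + v).+1 u N) //=; [|lia|lia].
rewrite [X in X + _]big1_seq ?add0r; last first.
  by move=> i /andP[_]; rewrite mem_index_iota => hi0; apply: h0; lia.
rewrite [X in _ + X]big1_seq ?addr0; last first.
  by move=> i /andP[_]; rewrite mem_index_iota => hi0; apply: h0; lia.
rewrite -{1}[u]add0n big_addn (_ : (u + v).+1 - u = v.+1)%N; last by lia.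
by apply: eq_bigr => i _; congr (h _); lia.
Qed.

Lemma isum_mull lo hi a h : isum lo hi (fun k => a * h k) = a * isum lo hi h.
Proof. by rewrite /isum; case: ifP => _; rewrite ?mulr0 // mulr_sumr. Qed.

Lemma eq_isum lo hi h h' : (forall k, lo <= k <= hi -> h k = h' k) ->
  isum lo hi h = isum lo hi h'.
Proof.
move=> e; rewrite /isum; case: ifP => // lh; apply: eq_bigr => k _; apply: e.
by have := ltn_ord k; lia.
Qed.

Lemma isum_empty lo hi h : hi < lo -> isum lo hi h = 0.
Proof. by rewrite /isum; case: ifP => //; lia. Qed.

(* The series sum_r X_r v^(r + p) in v = z^-1; the coefficients X_r with r < - p are
   dropped. *)
Definition ser (p : int) X : pser A := Pser (fun n => X (n%:Z - p)).

Lemma pcoef_ser p X n : pcoef (ser p X) n = X (n%:Z - p). Proof. by []. Qed.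

Lemma isum_conv lo hi p q (m : nat) X Y r :
  - p <= lo -> hi <= r + q -> r = m%:Z - p - q ->
  (forall k, k < lo -> X k = 0) -> (forall k, hi < k -> Y (r - k) = 0) ->
  isum lo hi (fun k => X k * Y (r - k)) = pcoef (ser p X * ser q Y) m.
Proof.
move=> plo hir rm X0 Y0.
rewrite (@isum_widen lo hi (- p) m.+1) //; first last.
- by move=> k [/X0->|/Y0->]; rewrite ?mul0r ?mulr0.
- by lia.
rewrite pcoefM; apply: eq_bigr => i _; rewrite !pcoef_ser.
by congr (X _ * Y _); have := ltn_ord i; lia.
Qed.
End FiniteSums.

Section GaussSeries.
Variables (A : pzRingType) (n : nat) (c : nat -> int).
Variables (e f : nat -> nat -> int -> A) (g : nat -> int -> A).
Hypothesis hc : forall k, (1 <= k <= n)%N -> c k <= c 1%N.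

Lemma fge_coef_lt i k j r : (1 <= k <= n)%N -> r < - c 1%N ->
  fge_coef c e f g i k j r = 0.
Proof. by move=> hk hr; apply: isum_empty; have := hc hk; lia. Qed.

(** Since c_1 bounds every c_k, the single shift by c_1, put on the diagonal factor, turns the
    triple product into one of power series. *)
Lemma fge_coef_series i k j (m : nat) : (1 <= k <= n)%N ->
  fge_coef c e f g i k j (m%:Z - c 1%N) =
  pcoef (ser 0 (fhat f i k) * ser (c 1%N) (ghat c g k) * ser 0 (ehat e k j)) m.
Proof.
move=> hk; have ck := hc hk.
have f0 a : a < 0 -> fhat f i k a = 0.
  by move=> a0; rewrite /fhat /kd; case: ifP => _; case: ifP => //; lia.
have e0 a : a < 0 -> ehat e k j a = 0.
  by move=> a0; rewrite /ehat /kd; case: ifP => _; case: ifP => //; lia.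
have g0 a : a < - c k -> ghat c g k a = 0.
  by move=> ?; rewrite /ghat; case: ifP => [|_]; [|case: ifP => //]; lia.
rewrite /fge_coef (@isum_widen A 0 _ 0 m.+1) //; first last.
- move=> a [/f0 fa|ha]; last by apply: isum_empty; lia.
  by rewrite /isum; case: ifP => // _; rewrite big1 // => l _; rewrite fa !mul0r.
- by lia.
rewrite -mulrA pcoefM; apply: eq_bigr => a _; have am := ltn_ord a.
rewrite pcoef_ser subr0 add0r.
under eq_isum => b _ do rewrite -mulrA.
rewrite isum_mull; congr (_ * _).
apply: isum_conv => //; [lia|lia|lia|].
by move=> l hl; apply: e0; lia.
Qed.
End GaussSeries.

(** * The RTT defect as an identity of power series *)

Section DefectSeries.
Variables (A : pzRingType) (n : nat) (t : nat -> nat -> int -> A) (c1 : int).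
Hypothesis t0 : forall a b r,
  (0 < a <= n)%N -> (0 < b <= n)%N -> r < - c1 -> t a b r = 0.
Local Notation T a b := (ser c1 (t a b)).

(* With r, a, b fixed, the left-hand side of the RTT relation is a derivation in the
   second factor, because the formal variable is central. *)
Definition rtt_der (r : int) (a b : nat) (s : pser A) : pser A :=
  pserX * lie (pserC (t a b (r + 1))) s - lie (pserC (t a b r)) s.

Lemma rtt_derD r a b s s' : rtt_der r a b (s + s') = rtt_der r a b s + rtt_der r a b s'.
Proof. by rewrite /rtt_der !lierD; ncring. Qed.
Lemma rtt_derM r a b s s' :
  rtt_der r a b (s * s') = rtt_der r a b s * s' + s * rtt_der r a b s'.
Proof.
rewrite /rtt_der !lierM; set u := pserC _; set v := pserC _.
have -> : s * (pserX * lie u s' - lie v s') = pserX * s * lie u s' - s * lie v s'.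
  by rewrite mulrBr mulrA pserX_comm.
by ncring.
Qed.

(** The relation is divided by w, so that w becomes 1 and the remaining terms get a factor w^-1. The
    coefficient of degree j is then the defect at s = j - 1 - c_1; for smaller s every term
    vanishes. *)
Lemma rtt_defect_series r a b c d : (0 < a <= n)%N -> (0 < b <= n)%N ->
  (0 < c <= n)%N -> (0 < d <= n)%N ->
  (forall s, rtt_defect t r s a b c d = 0) <->
  rtt_der r a b (T c d) =
    - (pserX * (pserC (t c b r) * T a d - T c b * pserC (t a d r))).
Proof.
move=> ha hb hc hd; have key (j : nat) : pcoef (rtt_der r a b (T c d)
    + pserX * (pserC (t c b r) * T a d - T c b * pserC (t a d r))) j
    = rtt_defect t r (j%:Z - 1 - c1) a b c d.
  rewrite /rtt_der !pcoefD pcoefN !pcoefXM pcoef_lieC pcoef_ser /rtt_defect.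
  have -> : j%:Z - 1 - c1 + 1 = j%:Z - c1 by lia.
  case: j => [|j].
    by rewrite !(@t0 _ _ (0 - 1 - c1)) //; try natlia; ncring.
  rewrite pcoef_lieC pcoefB pcoefCM pcoefMC !pcoef_ser.
  have -> : j.+1%:Z - 1 - c1 = j%:Z - c1 by lia.
  by ncring.
split=> [h|h s].
  by apply/eqP; rewrite -addr_eq0; apply/eqP/pserP => j; rewrite key h.
have [lt|ge] : (s < - c1 - 1 \/ - c1 - 1 <= s) by lia.
  by rewrite /rtt_defect !(@t0 _ _ s) ?(@t0 _ _ (s + 1)) //; try natlia; ncring.
have [j ->] : exists j : nat, s = j%:Z - 1 - c1 by exists (absz (s + 1 + c1)); lia.
by rewrite -key h addNr.
Qed.
End DefectSeries.

(** Bracketing Q(11,cd) with x_1 produces Q(12,cd) plus entries already known, and y_1 then raises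
    the first row index; so first factor t_11 is enough. *)
Lemma rtt_defect_gl2 (A : pzRingType) (t : nat -> nat -> int -> A) (x y : nat -> A)
    (dl : nat -> bool) :
  (forall r, col_act x (fun a b => t a b r) dl 2) ->
  (forall r, row_act y (fun a b => t a b r) dl 2) ->
  (forall r s c d, (0 < c <= 2)%N -> (0 < d <= 2)%N -> rtt_defect t r s 1 1 c d = 0) ->
  forall r s a b c d, (0 < a <= 2)%N -> (0 < b <= 2)%N -> (0 < c <= 2)%N ->
     (0 < d <= 2)%N -> rtt_defect t r s a b c d = 0.
Proof.
move=> X Y Q11 r s.
have Qx a b c d (ha : (0 < a <= 2)%N) (hb : (0 < b <= 2)%N) (hc : (0 < c <= 2)%N)
    (hd : (0 < d <= 2)%N) := lie_rtt_defect_col r s X (isT : 0 < 1 < 2)%N ha hb hc hd.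
have Qy a b c d (ha : (0 < a <= 2)%N) (hb : (0 < b <= 2)%N) (hc : (0 < c <= 2)%N)
    (hd : (0 < d <= 2)%N) := lie_rtt_defect_row r s Y (isT : 0 < 1 < 2)%N ha hb hc hd.
have Q12 c d : (0 < c <= 2)%N -> (0 < d <= 2)%N -> rtt_defect t r s 1 2 c d = 0.
  move=> hc hd; have := Qx 1%N 1%N c d isT isT hc hd.
  by rewrite !Q11 // lie0r !mul0rn addr0 !subr0 mulr1n => <-.
have Q1 b c d : (0 < b <= 2)%N -> (0 < c <= 2)%N -> (0 < d <= 2)%N ->
    rtt_defect t r s 1 b c d = 0.
  move=> hb hc hd; have [->|->] : (b = 1 \/ b = 2)%N by lia.
    exact: Q11.
  exact: Q12.
move=> a b c d ha hb hc hd; have [->|->] : (a = 1 \/ a = 2)%N by lia.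
  exact: Q1.
have := Qy 1%N b c d isT hb hc hd; rewrite !Q1 // lie0r !mul0rn addr0 subr0 sub0r mulr1n.
by move=> /esym/eqP; rewrite oppr_eq0 => /eqP.
Qed.

(** The last four hypotheses are the relations of t_11 with g_1, g_2, E_1 and F_1. The 2 x 2 block
    is polynomial in these series and [rtt_der t r 1 1] is a derivation, so they settle every
    Q(11,cd) in that block. *)
Lemma gauss_rtt (A : pzRingType) (x y : nat -> A) (g E F : nat -> pser A)
    (dl : nat -> bool) (n : nat) (c1 : int) (t : nat -> nat -> int -> A)
    (X := fun i => pserC (x i)) (Y := fun i => pserC (y i)) :
  (forall z : A, z + z = 0 -> z = 0) -> (1 < n)%N ->
  gauss_rels X Y g E F dl n ->
  (forall a b r, (0 < a <= n)%N -> (0 < b <= n)%N -> r < - c1 -> t a b r = 0) ->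
  (forall a b, (0 < a <= n)%N -> (0 < b <= n)%N ->
     ser c1 (t a b) = gauss_t X Y g E F a b) ->
  (forall r, lie (pserC (t 1%N 1%N r)) (g 1%N) = 0) ->
  (forall r, lie (pserC (t 1%N 1%N r)) (g 2%N) = 0) ->
  (forall r, rtt_der t r 1 1 (E 1%N) =
     pserX * (pserC (t 1%N 2%N r) - pserC (t 1%N 1%N r) * E 1%N)) ->
  (forall r, rtt_der t r 1 1 (F 1%N) =
     pserX * (F 1%N * pserC (t 1%N 1%N r) - pserC (t 2%N 1%N r))) ->
  forall r s a b c d, (0 < a <= n)%N -> (0 < b <= n)%N -> (0 < c <= n)%N ->
     (0 < d <= n)%N -> rtt_defect t r s a b c d = 0.
Proof.
move=> tf n1 H t0 tE g1 g2 DE DF r s.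
have tfL (z : pser A) : z + z = 0 -> z = 0.
  by move=> z0; apply: pserP => j; apply: tf; rewrite -pcoefD z0.
have cact m q : (1 < m <= n)%N -> col_act x (fun a b => t a b q) dl m.
  move=> hm i a b hi ha hb.
  have [lt|ge] : (q < - c1 \/ - c1 <= q) by lia.
    by rewrite !t0 ?mul0rn ?subr0 ?lie0r //; lia.
  have [j ->] : exists j : nat, q = j%:Z - c1 by exists (absz (q + c1)); lia.
  have hact := gauss_col_act H tfL hm hi ha hb.
  have := congr1 (fun p => pcoef p j) hact.
  rewrite pcoef_lieC pcoefB !pcoefMn -tE ?pcoef_ser; try natlia.
  move=> ->; congr (_ - _).
    by case: (b =P i) => [e|_]; rewrite ?mulr0n // -tE //; lia.
  by case: (a =P i.+1) => [e|_]; rewrite ?mulr0n // -tE //; lia.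
have ract m q : (1 < m <= n)%N -> row_act y (fun a b => t a b q) dl m.
  move=> hm i a b hi ha hb.
  have [lt|ge] : (q < - c1 \/ - c1 <= q) by lia.
    by rewrite !t0 ?mul0rn ?subr0 ?lie0r //; lia.
  have [j ->] : exists j : nat, q = j%:Z - c1 by exists (absz (q + c1)); lia.
  have hact := gauss_row_act H tfL hm hi ha hb.
  have := congr1 (fun p => pcoef p j) hact.
  rewrite pcoef_lieC pcoefB !pcoefMn -tE ?pcoef_ser; try natlia.
  move=> ->; congr (_ - _).
    by case: (b =P i.+1) => [e|_]; rewrite ?mulr0n // -tE //; lia.
  by case: (a =P i) => [e|_]; rewrite ?mulr0n // -tE //; lia.
have T11 : ser c1 (t 1%N 1%N) = g 1%N.
  by rewrite tE ?gauss_t_diag ?big_geq ?add0r //; lia.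
have T12 : ser c1 (t 1%N 2%N) = g 1%N * E 1%N.
  by rewrite tE /gauss_t ?big_nat1 /= ?mul1r //; lia.
have T21 : ser c1 (t 2%N 1%N) = F 1%N * g 1%N.
  by rewrite tE /gauss_t ?big_nat1 /= ?mulr1 //; lia.
have T22 : ser c1 (t 2%N 2%N) = F 1%N * g 1%N * E 1%N + g 2%N.
  by rewrite tE ?gauss_t_diag ?big_nat1 //=; lia.
have D11 q : rtt_der t q 1 1 (g 1%N) = 0 by rewrite /rtt_der !g1 mulr0 subr0.
have D22 q : rtt_der t q 1 1 (g 2%N) = 0 by rewrite /rtt_der !g2 mulr0 subr0.
have gC q : pserC (t 1%N 1%N q) * g 1%N = g 1%N * pserC (t 1%N 1%N q).
  by apply/eqP; rewrite -subr_eq0 -lieE g1.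
have D12 q : rtt_der t q 1 1 (g 1%N * E 1%N) =
    pserX * (g 1%N * pserC (t 1%N 2%N q) - pserC (t 1%N 1%N q) * (g 1%N * E 1%N)).
  by rewrite rtt_derM D11 mul0r add0r DE !mulrA gC -pserX_comm; ncring.
have Q11 q s' c d : (0 < c <= 2)%N -> (0 < d <= 2)%N -> rtt_defect t q s' 1 1 c d = 0.
  move=> hc hd; move: s'; apply/(rtt_defect_series t0); try natlia.
  have [->|->] : (c = 1 \/ c = 2)%N by lia.
    have [->|->] : (d = 1 \/ d = 2)%N by lia.
      by rewrite T11 D11 gC subrr mulr0 oppr0.
    by rewrite T12 D12 T11; ncring.
  have [->|->] : (d = 1 \/ d = 2)%N by lia.
    by rewrite T21 T11 rtt_derM D11 DF mulr0 addr0 -!mulrA mulrBl -!mulrA gC; ncring.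
  rewrite T22 T12 T21 rtt_derD D22 addr0 -mulrA rtt_derM DF D12.
  by rewrite !mulrA -pserX_comm; ncring.
have Qm m a b c d : (1 < m <= n)%N -> (0 < a <= m)%N -> (0 < b <= m)%N ->
    (0 < c <= m)%N -> (0 < d <= m)%N -> rtt_defect t r s a b c d = 0.
  elim: m a b c d => [//|[//|q] IH] a b c d hm.
  have [q0|q0] := posnP q.
    rewrite q0; apply: (rtt_defect_gl2 (x := x) (y := y) (dl := dl)) => // u;
      [apply: cact|apply: ract]; lia.
  move: a b c d; apply: (@rtt_defect_step _ _ x y dl q) => //.
  - by move=> u; apply: cact.
  - by move=> u; apply: ract.
  - by move=> a b c d; apply: IH; lia.
by move=> a b c d; apply: Qm; lia.
Qed.

(** * From the Drinfeld relations to the RTT relations *)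

Section Convolution.
Variable A : pzRingType.
Implicit Types (X Y h : int -> A).

Lemma pcoefMr (p q : pser A) n :
  pcoef (p * q) n = \sum_(i < n.+1) pcoef p (n - i)%N * pcoef q i.
Proof.
rewrite pcoefM (reindex_inj rev_ord_inj) /=; apply: eq_bigr => i _.
by rewrite subSS subKn // -ltnS.
Qed.

Lemma isum_convr (lo hi p q : int) (m : nat) X Y r :
  - p <= lo -> hi <= r + q -> r = m%:Z - p - q ->
  (forall k, k < lo -> Y k = 0) -> (forall k, hi < k -> X (r - k) = 0) ->
  isum lo hi (fun k => X (r - k) * Y k) = pcoef (ser q X * ser p Y) m.
Proof.
move=> plo hir rm X0 Y0.
rewrite (@isum_widen _ lo hi (- p) m.+1) //; first last.
- by move=> k [/X0->|/Y0->]; rewrite ?mul0r ?mulr0.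
- by lia.
rewrite pcoefMr; apply: eq_bigr => i _; rewrite !pcoef_ser.
by congr (X _ * Y _); have := ltn_ord i; lia.
Qed.

Lemma isum_recr (lo hi : int) h : lo <= hi -> isum lo hi h = isum lo (hi - 1) h + h hi.
Proof.
move=> lohi; have [N hN] : exists N : nat, hi = lo + N%:Z.
  by exists (absz (hi - lo)); lia.
rewrite /isum lohi hN; case: N hN => [|N] hN.
  have -> : absz (lo + 0%:Z - lo)%R = 0%N by lia.
  by rewrite ifF ?add0r ?big_ord1 //; lia.
have -> : absz (lo + N.+1%:Z - lo)%R = N.+1 by lia.
have -> : absz (lo + N.+1%:Z - 1 - lo)%R = N by lia.
by rewrite big_ord_recr ifT //; lia.
Qed.

Lemma ser_comm p q X Y : (forall i j, X i * Y j = Y j * X i) ->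
  ser p X * ser q Y = ser q Y * ser p X.
Proof.
move=> XY; apply: pserP => n; rewrite pcoefM pcoefMr.
by apply: eq_bigr => i _; rewrite XY.
Qed.

Lemma ser_shift p (N : nat) X : (forall k, k < - p -> X k = 0) ->
  ser (p + N%:Z) X = pserX ^+ N * ser p X.
Proof.
move=> X0; apply: pserP => n; rewrite pcoefXnM !pcoef_ser; case: ifP => h.
  by congr (X _); lia.
by apply: X0; lia.
Qed.

Lemma pserXn_comm N (p : pser A) : pserX ^+ N * p = p * pserX ^+ N.
Proof.
elim: N => [|N IH]; first by rewrite expr0 mul1r mulr1.
by rewrite exprS -mulrA IH mulrA pserX_comm -mulrA.
Qed.
End Convolution.

Section DrinfeldGauss.
Variables (A : pzRingType) (n : nat) (c : nat -> int).
Variables (E F D Dt : nat -> int -> A).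
Hypothesis hc : dominant n c.
Hypothesis hr : Drinfeld_rels n (fun j => - c j) E F D Dt.

Let G := ghat c D.
(** The families are unconstrained outside the generator ranges, so those values have to be cut off
    before a series is formed. *)
Definition pos_part (h : int -> A) (r : int) : A := if (1 <= r)%R then h r else 0.
Let Eh i := pos_part (E i).
Let Fh i := pos_part (F i).

Lemma dominant_le1 k : (1 <= k <= n)%N -> c k <= c 1%N.
Proof.
elim: k => // -[|k] IH hk //; apply: Order.POrderTheory.le_trans (IH _); last by lia.
by apply: hc; lia.
Qed.

Lemma ghatD k r : idx_diag n k -> - c k <= r -> G k r = D k r.
Proof.
case: hr => D1 _ hk hkr; rewrite /G /ghat; case: eqP => [->|ne]; first by rewrite D1.
by rewrite ifT //; lia.
Qed.
Lemma ghat_lt k r : r < - c k -> G k r = 0.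
Proof. by move=> h; rewrite /G /ghat ifF ?ifF //; lia. Qed.
Lemma ghat_lead k : G k (- c k) = 1.
Proof. by rewrite /G /ghat eqxx. Qed.

Lemma ghat_ghat i j r s : idx_diag n i -> idx_diag n j -> lie (G i r) (G j s) = 0.
Proof.
move=> hi hj; have [lt|ge] : (r < - c i \/ - c i <= r) by lia.
  by rewrite ghat_lt // lie0l.
have [lt'|ge'] : (s < - c j \/ - c j <= s) by lia.
  by rewrite (ghat_lt lt') lie0r.
by case: hr => _ [_ [DD _]]; rewrite !ghatD // lieE; apply: DD.
Qed.

Lemma ghat_E i j r s : idx_diag n i -> idx_simple n j -> 1 <= s ->
  lie (G i r) (E j s) = (kd A i%:Z j.+1%:Z - kd A i%:Z j%:Z) *
    isum (- c i) (r - 1) (fun t => G i t * E j (r + s - 1 - t)).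
Proof.
move=> hi hj hs; have [lt|ge] : (r < - c i \/ - c i <= r) by lia.
  by rewrite ghat_lt // lie0l isum_empty ?mulr0 //; lia.
case: hr => _ [_ [_ [_ [DE _]]]]; rewrite ghatD // lieE.
rewrite -[LHS]/(comm (D i r) (E j s)) (DE i j r s hi hj ge hs); congr (_ * _).
apply: eq_isum => t ht; rewrite ghatD //; last by lia.
by congr (_ * E j _); lia.
Qed.
Lemma ghat_F i j r s : idx_diag n i -> idx_simple n j -> 1 <= s ->
  lie (G i r) (F j s) = (kd A i%:Z j%:Z - kd A i%:Z j.+1%:Z) *
    isum (- c i) (r - 1) (fun t => F j (r + s - 1 - t) * G i t).
Proof.
move=> hi hj hs; have [lt|ge] : (r < - c i \/ - c i <= r) by lia.
  by rewrite ghat_lt // lie0l isum_empty ?mulr0 //; lia.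
case: hr => _ [_ [_ [_ [_ [DF _]]]]]; rewrite ghatD // lieE.
rewrite -[LHS]/(comm (D i r) (F j s)) (DF i j r s hi hj ge hs); congr (_ * _).
apply: eq_isum => t ht; rewrite ghatD //; last by lia.
by congr (F j _ * _); lia.
Qed.

Lemma kd_eq (i j : nat) : kd A i%:Z j%:Z = (i == j)%:R.
Proof. by rewrite /kd eqz_nat; case: eqP. Qed.

Local Notation x i := (pserC (E i 1)).
Local Notation y i := (pserC (F i 1)).
Local Notation GS i := (ser (c 1%N) (G i)).
Local Notation ES i := (ser 0 (Eh i)).
Local Notation FS i := (ser 0 (Fh i)).
Definition flat (i : nat) : bool := c i == c i.+1.

Lemma lie_E_G i j r : idx_diag n i -> idx_simple n j -> i <> j -> i <> j.+1 ->
  lie (E j 1) (G i r) = 0.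
Proof.
move=> hi hj ij ij1; rewrite lieC ghat_E // !kd_eq.
have [-> ->] : (i == j.+1) = false /\ (i == j) = false by lia.
by rewrite subrr mul0r oppr0.
Qed.
Lemma lie_F_G i j r : idx_diag n i -> idx_simple n j -> i <> j -> i <> j.+1 ->
  lie (F j 1) (G i r) = 0.
Proof.
move=> hi hj ij ij1; rewrite lieC ghat_F // !kd_eq.
have [-> ->] : (i == j.+1) = false /\ (i == j) = false by lia.
by rewrite subrr mul0r oppr0.
Qed.

(** With second superscript 1 the truncated sum in the relation between D_i and E_i is the full
    convolution: the E-factor has superscript r - t, and t <= r - 1 says that it is positive. *)
Lemma lie_x_GS i : idx_simple n i -> lie (x i) (GS i) = GS i * ES i.
Proof.
move=> hi; apply: pserP => m; rewrite pcoef_lieC pcoef_ser lieC ghat_E //; last first.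
  by move: hi; rewrite /idx_simple /idx_diag; lia.
rewrite !kd_eq eqxx (_ : (i == i.+1) = false); last by lia.
rewrite sub0r mulN1r opprK.
rewrite -(@isum_conv _ (- c i) (m%:Z - c 1%N - 1) (c 1%N) 0 m _ _ (m%:Z - c 1%N)); first last.
- by move=> k hk; rewrite /Eh /pos_part ifF //; lia.
- by move=> k; apply: ghat_lt.
- by lia.
- by lia.
- by have := @dominant_le1 i; move: hi; rewrite /idx_simple; lia.
apply: eq_isum => t ht; rewrite /Eh /pos_part ifT; last by lia.
by congr (_ * E _ _); lia.
Qed.
Lemma lie_y_GS i : idx_simple n i -> lie (y i) (GS i) = - (FS i * GS i).
Proof.
move=> hi; apply: pserP => m; rewrite pcoef_lieC pcoef_ser lieC ghat_F //; last first.
  by move: hi; rewrite /idx_simple /idx_diag; lia.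
rewrite !kd_eq eqxx (_ : (i == i.+1) = false); last by lia.
rewrite subr0 mul1r; congr (- _).
rewrite -(@isum_convr _ (- c i) (m%:Z - c 1%N - 1) (c 1%N) 0 m _ _ (m%:Z - c 1%N)); first last.
- by move=> k hk; rewrite /Fh /pos_part ifF //; lia.
- by move=> k; apply: ghat_lt.
- by lia.
- by lia.
- by have := @dominant_le1 i; move: hi; rewrite /idx_simple; lia.
apply: eq_isum => t ht; rewrite /Fh /pos_part ifT; last by lia.
by congr (F _ _ * _); lia.
Qed.

Let Dth i (t : int) : A := if (c i <= t)%R then Dt i t else 0.

Lemma DthE i t : c i <= t -> Dth i t = Dt i t.
Proof. by rewrite /Dth => ->. Qed.

Lemma ser_D_Dt i : idx_diag n i -> ser (c i) (G i) * ser (- c i) (Dth i) = -1.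
Proof.
move=> hi; apply: pserP => m.
rewrite -(@isum_conv _ (- c i) (m%:Z - c i) (c i) (- c i) m _ _ m%:Z); first last.
- by move=> k hk; rewrite /Dth ifF //; lia.
- by move=> k; apply: ghat_lt.
- by lia.
- by lia.
- by lia.
case: hr => _ [DDt _]; have := DDt i m%:Z hi.
rewrite pcoefN pcoef1 /kd eqz_nat => <-.
apply: eq_isum => t ht; rewrite ghatD //; last by lia.
by rewrite /Dth ifT //; lia.
Qed.

Lemma monic_G i : monic_at 0 (ser (c i) (G i)).
Proof. by split=> //; rewrite pcoef_ser sub0r ghat_lead. Qed.

(** The relations provide Dt_i only as a right inverse, up to sign; cancelling the monic series D_i
    on the left makes it two-sided. *)
Lemma ser_Dt_D i : idx_diag n i -> ser (- c i) (Dth i) * ser (c i) (G i) = -1.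
Proof.
move=> hi; apply/eqP; rewrite -subr_eq0; apply/eqP/(monic_at_lreg (monic_G i)).
by rewrite mulrBr mulrA ser_D_Dt //; ncring.
Qed.

(* D_i(z)^-1 D_{i+1}(z); the sign compensates that Dt_i(z) = - D_i(z)^-1. *)
Definition ef_series i : pser A := - (ser (- c i) (Dth i) * ser (c i) (G i.+1)).

Lemma ser_comm_G i j p q : idx_diag n i -> idx_diag n j ->
  ser p (G i) * ser q (G j) = ser q (G j) * ser p (G i).
Proof.
move=> hi hj; apply: ser_comm => r s; apply/eqP; rewrite -subr_eq0 -lieE.
by rewrite ghat_ghat.
Qed.

Lemma simple_diag i : idx_simple n i ->
  [/\ idx_diag n i, idx_diag n i.+1, c i.+1 <= c i & c i <= c 1%N].
Proof.
move=> hi; have h1 : idx_diag n i by move: hi; rewrite /idx_simple /idx_diag; lia.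
split=> //; first by move: hi; rewrite /idx_simple /idx_diag; lia.
  exact: hc.
exact: dominant_le1.
Qed.

Lemma ef_series_GS i : idx_simple n i -> ef_series i * GS i = GS i.+1.
Proof.
move=> /simple_diag[hi hi1 ci c1i].
have [N eN] : exists N : nat, c 1%N = c i + N%:Z by exists (absz (c 1%N - c i)); lia.
rewrite eN !ser_shift; first last.
- by move=> k; apply: ghat_lt.
- by move=> k hk; apply: ghat_lt; lia.
rewrite /ef_series pserXn_comm mulrA mulNr -mulrA ser_comm_G // mulrA ser_Dt_D //.
by rewrite mulN1r opprK -pserXn_comm.
Qed.

Lemma lie_E_F i j r s : idx_simple n i -> idx_simple n j -> 1 <= r -> 1 <= s ->
  i <> j -> lie (E i r) (F j s) = 0.
Proof.
move=> hi hj hr1 hs1 ij; case: hr => _ [_ [_ [EF _]]].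
rewrite lieE -[LHS]/(comm _ _) EF //; case: eqP => // _; exact: oppr0.
Qed.

Lemma ef_seriesE i m : idx_simple n i -> (0 < m)%N ->
  lie (E i 1) (F i m%:Z) = pcoef (ef_series i) m.
Proof.
move=> hs m0; have [hi hi1 ci c1i] := simple_diag hs.
case: hr => _ [_ [_ [EF _]]]; rewrite lieE -[LHS]/(comm _ _) EF //.
rewrite eqxx /ef_series pcoefN; congr (- _); rewrite opprK.
rewrite -(@isum_conv _ (c i) (m%:Z + c i.+1) (- c i) (c i) m _ _ m%:Z); first last.
- by move=> k hk; apply: ghat_lt; lia.
- by move=> k hk; rewrite /Dth ifF //; lia.
- by lia.
- by lia.
- by lia.
have -> : 1 + m%:Z - 1 - - c i.+1 = m%:Z + c i.+1 by lia.
apply: eq_isum => t ht; rewrite /Dth ifT ?ghatD //; try natlia.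
  by congr (_ * D _ _); lia.
Qed.

Lemma Dt_lead i : idx_diag n i -> Dt i (c i) = -1.
Proof.
move=> hi; have := congr1 (fun p => pcoef p 0) (ser_D_Dt hi).
rewrite pcoefM big_ord1 !pcoef_ser !sub0r opprK ghat_lead mul1r /Dth ifT //.
Qed.
Lemma Dt_next i : idx_diag n i -> Dt i (c i + 1) = G i (1 - c i).
Proof.
move=> hi; have := congr1 (fun p => pcoef p 1) (ser_D_Dt hi).
rewrite pcoefM !big_ord_recl big_ord0 !pcoef_ser /= !sub0r !opprK ghat_lead mul1r.
rewrite !DthE ?Dt_lead ?lerDr // subn0 (addrC 1%:Z) mulrN1 addr0 oppr0 => /eqP.
by rewrite subr_eq0 (addrC 1) => /eqP->.
Qed.

(** The origin of the flag: D_i(z)^-1 D_{i+1}(z) has leading term z^(c_{i+1} - c_i), whereas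
    [x_i, F_i(z)] starts at z^-1, so this constant term must be subtracted. *)
Lemma ef_series0 i : idx_simple n i -> pcoef (ef_series i) 0 = 1 *+ flat i.
Proof.
move=> /simple_diag[hi hi1 ci c1i].
rewrite /ef_series pcoefN pcoefM big_ord1 !pcoef_ser !sub0r opprK /Dth ifT // Dt_lead //.
rewrite mulN1r opprK /flat; case: eqP => [->|ne]; first by rewrite ghat_lead.
by rewrite ghat_lt //; lia.
Qed.

Lemma ef_series1 i : idx_simple n i ->
  pcoef (ef_series i) 1 = if flat i then G i.+1 (1 - c i.+1) - G i (1 - c i)
                          else G i.+1 (1 - c i).
Proof.
move=> /simple_diag[hi hi1 ci c1i].
rewrite /ef_series pcoefN pcoefM !big_ord_recl big_ord0 !pcoef_ser /= sub0r opprK.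
rewrite (_ : bump 0 0 = 1%N) // subn0 subnn sub0r (addrC 1%:Z (c i)) !DthE ?lerDl //.
rewrite Dt_lead // Dt_next // !mulN1r addr0 /flat.
case: eqP => [e|ne]; first by rewrite e ghat_lead; ncring.
have -> : G i.+1 (- c i) = 0 by apply: ghat_lt; lia.
by ncring.
Qed.

Lemma ghat_E1 i j s : idx_diag n i -> idx_simple n j -> 1 <= s ->
  lie (G i (1 - c i)) (E j s) = ((i == j.+1)%:R - (i == j)%:R) * E j s.
Proof.
move=> hi hj hs; rewrite ghat_E // !kd_eq; congr (_ * _).
rewrite isum_recr ?isum_empty ?add0r; try natlia.
have -> : 1 - c i - 1 = - c i by lia.
by rewrite ghat_lead mul1r; congr (E _ _); lia.
Qed.
Lemma ghat_F1 i j s : idx_diag n i -> idx_simple n j -> 1 <= s ->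
  lie (G i (1 - c i)) (F j s) = ((i == j)%:R - (i == j.+1)%:R) * F j s.
Proof.
move=> hi hj hs; rewrite ghat_F // !kd_eq; congr (_ * _).
rewrite isum_recr ?isum_empty ?add0r; try natlia.
have -> : 1 - c i - 1 = - c i by lia.
by rewrite ghat_lead mulr1; congr (F _ _); lia.
Qed.

Local Notation kappa i := (lie (E i 1) (F i 1)).

(** If c_{i+1} < c_i, the superscript 1 - c_i is at most - c_{i+1}, so the coefficient is 0 or 1 and
    kappa is central. In the flat case kappa is a difference of first nontrivial coefficients and
    acts by Cartan weights. *)
Lemma kappaE i : idx_simple n i ->
  kappa i = if flat i then G i.+1 (1 - c i.+1) - G i (1 - c i) else G i.+1 (1 - c i).
Proof. by move=> hi; rewrite (@ef_seriesE i 1) // ef_series1. Qed.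

Lemma lie_central_ghat k r z : r <= - c k -> lie (G k r) z = 0 :> A.
Proof.
move=> h; have [->|lt] : (r = - c k \/ r < - c k) by lia.
  by rewrite ghat_lead; ncring.
by rewrite ghat_lt // lie0l.
Qed.

Lemma lieBl (L : pzRingType) (a b z : L) : lie (a - b) z = lie a z - lie b z.
Proof. by ncring. Qed.

Lemma lie_kappa_G i j r : idx_simple n i -> idx_diag n j -> lie (kappa i) (G j r) = 0.
Proof.
move=> hi hj; have [h1 h2 _ _] := simple_diag hi; rewrite kappaE //.
by case: ifP => _; rewrite ?lieBl !ghat_ghat ?subr0.
Qed.

(** The Cartan matrix of type A, as the difference of the weights of D_{i+1} and D_i on E_j. *)
Definition cartan (i j : nat) : A :=
  ((i.+1 == j.+1)%:R - (i.+1 == j)%:R) - ((i == j.+1)%:R - (i == j)%:R).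

Lemma lie_kappa_E i j s : idx_simple n i -> idx_simple n j -> 1 <= s ->
  lie (kappa i) (E j s) = cartan i j * E j s *+ flat i.
Proof.
move=> hi hj hs; have [h1 h2 ci _] := simple_diag hi; rewrite kappaE // /flat.
case: eqP => [e|ne]; first by rewrite lieBl !ghat_E1 // /cartan mulr1n -mulrBl.
by rewrite mulr0n lie_central_ghat //; lia.
Qed.
Lemma lie_kappa_F i j s : idx_simple n i -> idx_simple n j -> 1 <= s ->
  lie (kappa i) (F j s) = - (cartan i j * F j s *+ flat i).
Proof.
move=> hi hj hs; have [h1 h2 ci _] := simple_diag hi; rewrite kappaE // /flat.
case: eqP => [e|ne]; first by rewrite lieBl !ghat_F1 // /cartan mulr1n; ncring.
by rewrite mulr0n oppr0 lie_central_ghat //; lia.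
Qed.

Lemma cartan_far i j : (j.+1 < i)%N -> cartan i j = 0.
Proof.
move=> h; rewrite /cartan; have [-> [-> [-> ->]]] : (i.+1 == j.+1) = false /\
  (i.+1 == j) = false /\ (i == j.+1) = false /\ (i == j) = false by lia.
by rewrite !subr0.
Qed.
Lemma cartan_next i : cartan i.+1 i = -1.
Proof.
rewrite /cartan eqxx; have [-> [-> ->]] : (i.+2 == i.+1) = false /\
  (i.+2 == i) = false /\ (i.+1 == i) = false by lia.
by rewrite !subr0 sub0r.
Qed.
Lemma cartan_diag i : cartan i i = 1 + 1.
Proof.
rewrite /cartan !eqxx; have [-> ->] : (i.+1 == i) = false /\ (i == i.+1) = false by lia.
by rewrite subr0 sub0r opprK.
Qed.

Lemma pcoef_pos (h : int -> A) m : pcoef (ser 0 (pos_part h)) m = if m is 0 then 0 else h m.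
Proof. by rewrite pcoef_ser subr0 /pos_part; case: m. Qed.

Lemma lie_E_far i j r s : idx_simple n i -> idx_simple n j -> (i.+1 < j)%N ->
  1 <= r -> 1 <= s -> lie (E i r) (E j s) = 0 /\ lie (F i r) (F j s) = 0.
Proof.
move=> hi hj ij h1 h2; rewrite !lieE; case: hr => _ [_ [_ [_ [_ [_ [_ [_ [_ [_ [EE _]]]]]]]]]].
by apply: EE => //; lia.
Qed.

(** At equal superscripts the two summands of the symmetrised relation coincide, so it only says
    that twice the bracket is zero. *)
Lemma serre_E i j : idx_simple n i -> idx_simple n j -> `|i%:Z - j%:Z| = 1 ->
  (forall z : A, z + z = 0 -> z = 0) ->
  lie (E i 1) (lie (E i 1) (E j 1)) = 0 /\ lie (F i 1) (lie (F i 1) (F j 1)) = 0.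
Proof.
move=> hi hj ij tf; case: hr => _ [_ [_ [_ [_ [_ [_ [_ [_ [_ [_ S]]]]]]]]]].
have [S1 S2] := S i j 1 1 1 hi hj ij isT isT isT.
by rewrite !lieE; split; apply: tf.
Qed.

Lemma lie_E_self s : idx_simple n 1 -> 1 <= s ->
  lie (E 1%N 1) (E 1%N s) = - isum 1 (s - 1) (fun t => E 1%N t * E 1%N (s - t)).
Proof.
move=> h1 hs; case: hr => _ [_ [_ [_ [_ [_ [EE _]]]]]].
rewrite lieE -[LHS]/(comm _ _) EE // isum_empty // sub0r; congr (- _).
by apply: eq_isum => t ht; congr (_ * E _ _); lia.
Qed.
Lemma lie_F_self s : idx_simple n 1 -> 1 <= s ->
  lie (F 1%N 1) (F 1%N s) = isum 1 (s - 1) (fun t => F 1%N (s - t) * F 1%N t).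
Proof.
move=> h1 hs; case: hr => _ [_ [_ [_ [_ [_ [_ [FF _]]]]]]].
rewrite lieE -[LHS]/(comm _ _) FF // [X in _ - X]isum_empty // subr0.
by apply: eq_isum => t ht; congr (F _ _ * _); lia.
Qed.

Lemma pos_part_lt (h : int -> A) k : k < 1 -> pos_part h k = 0.
Proof. by move=> hk; rewrite /pos_part ifF //; lia. Qed.
Lemma pos_part_ge (h : int -> A) k : 1 <= k -> pos_part h k = h k.
Proof. by move=> hk; rewrite /pos_part hk. Qed.

Lemma lie_x_ES1 : idx_simple n 1 -> lie (x 1%N) (ES 1%N) = - (ES 1%N * ES 1%N).
Proof.
move=> h1; apply: pserP => m; rewrite pcoef_lieC pcoefN pcoef_pos.
rewrite -(@isum_conv _ 1 (m%:Z - 1) 0 0 m _ _ m%:Z); first last.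
- by move=> k hk; apply: pos_part_lt; lia.
- by move=> k hk; apply: pos_part_lt; lia.
- by lia.
- by lia.
- by [].
case: m => [|m]; first by rewrite lie0r isum_empty // oppr0.
rewrite lie_E_self //; congr (- _); apply: eq_isum => t ht.
by rewrite /Eh !pos_part_ge //; lia.
Qed.
Lemma lie_y_FS1 : idx_simple n 1 -> lie (y 1%N) (FS 1%N) = FS 1%N * FS 1%N.
Proof.
move=> h1; apply: pserP => m; rewrite pcoef_lieC pcoef_pos.
rewrite -(@isum_convr _ 1 (m%:Z - 1) 0 0 m _ _ m%:Z); first last.
- by move=> k hk; apply: pos_part_lt; lia.
- by move=> k hk; apply: pos_part_lt; lia.
- by lia.
- by lia.
- by [].
case: m => [|m]; first by rewrite lie0r isum_empty.
rewrite lie_F_self //; apply: eq_isum => t ht.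
by rewrite /Fh !pos_part_ge //; lia.
Qed.

Lemma lie_x_FS_GS i : idx_simple n i ->
  lie (x i) (FS i) * GS i = GS i.+1 - GS i *+ flat i.
Proof.
move=> hi; rewrite -ef_series_GS //.
have -> : lie (x i) (FS i) = ef_series i - 1 *+ flat i.
  apply: pserP => m; rewrite pcoef_lieC pcoefB pcoefMn pcoef_pos pcoef1.
  case: m => [|m]; first by rewrite lie0r ef_series0 // subrr.
  by rewrite ef_seriesE // mul0rn subr0.
by rewrite mulrBl mulrnAl mul1r.
Qed.

Lemma lie_kappa_series i : lie (x i) (y i) = pserC (kappa i).
Proof. by rewrite pserC_lie. Qed.

Lemma lieC_pos0 a (h : int -> A) : (forall s, 1 <= s -> lie a (h s) = 0) ->
  lie (pserC a) (ser 0 (pos_part h)) = 0.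
Proof.
move=> h0; apply: pserP => m; rewrite pcoef_lieC pcoef_pos.
by case: m => [|m]; rewrite ?lie0r ?h0.
Qed.

Lemma lie_kappa_ES i j : idx_simple n i -> idx_simple n j ->
  lie (lie (x i) (y i)) (ES j) = pserC (cartan i j) * ES j *+ flat i.
Proof.
move=> hi hj; rewrite lie_kappa_series; apply: pserP => m.
rewrite pcoef_lieC pcoefMn pcoefCM pcoef_pos.
by case: m => [|m]; rewrite ?lie0r ?mulr0 ?mul0rn // lie_kappa_E.
Qed.
Lemma lie_kappa_FS i j : idx_simple n i -> idx_simple n j ->
  lie (lie (x i) (y i)) (FS j) = - (pserC (cartan i j) * FS j *+ flat i).
Proof.
move=> hi hj; rewrite lie_kappa_series; apply: pserP => m.
rewrite pcoef_lieC pcoefN pcoefMn pcoefCM pcoef_pos.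
by case: m => [|m]; rewrite ?lie0r ?mulr0 ?mul0rn ?oppr0 // lie_kappa_F.
Qed.

Hypothesis tf : forall z : A, z + z = 0 -> z = 0.
Hypothesis n2 : (1 < n)%N.

Lemma drinfeld_gauss_rels :
  gauss_rels (fun i => x i) (fun i => y i) (fun i => GS i) (fun i => ES i) (fun i => FS i)
    flat n.
Proof.
have sp k : (0 < k)%N -> (k < n)%N -> idx_simple n k by rewrite /idx_simple => -> ->.
have dg k : (0 < k)%N -> (k <= n)%N -> idx_diag n k by rewrite /idx_diag => -> ->.
have C0 (a b : A) : lie a b = 0 -> lie (pserC a) (pserC b) = 0.
  by move=> h; rewrite -pserC_lie h pserC0.
split.
- by move=> i j hi hj; apply: C0; apply: (lie_E_far _ _ _ _ _).1 => //; [apply: sp|apply: sp|]; lia.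
- by move=> i j hi hj; apply: C0; apply: (lie_E_far _ _ _ _ _).2 => //; [apply: sp|apply: sp|]; lia.
- by move=> i j hi hj ij; apply: C0; apply: lie_E_F => //; apply: sp; lia.
- move=> i hi hi1; rewrite -!pserC_lie (serre_E _ _ _ tf).1 ?pserC0 //; try (apply: sp); lia.
- move=> i hi hi1; rewrite -!pserC_lie (serre_E _ _ _ tf).1 ?pserC0 //; try (apply: sp); lia.
- move=> i hi hi1; rewrite -!pserC_lie (serre_E _ _ _ tf).2 ?pserC0 //; try (apply: sp); lia.
- move=> i hi hi1; rewrite -!pserC_lie (serre_E _ _ _ tf).2 ?pserC0 //; try (apply: sp); lia.
- move=> i j hi hj; apply: lieC_pos0 => s hs.
  by apply: lie_swap0; apply: (lie_E_far _ _ _ _ _).1 => //; [apply: sp|apply: sp|]; lia.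
- move=> i j hi hj; apply: lieC_pos0 => s hs.
  by apply: lie_swap0; apply: (lie_E_far _ _ _ _ _).2 => //; [apply: sp|apply: sp|]; lia.
- move=> i j hi hj; apply: lieC_pos0 => s hs.
  by apply: lie_E_F => //; [apply: sp|apply: sp|]; lia.
- move=> i j hi hj; apply: lieC_pos0 => s hs; apply: lie_swap0.
  by apply: lie_E_F => //; [apply: sp|apply: sp|]; lia.
- move=> i j hi hj; apply: pserP => m; rewrite pcoef_lieC pcoef_ser.
  by apply: lie_E_G; [apply: dg|apply: sp| |]; lia.
- move=> i j hi hj; apply: pserP => m; rewrite pcoef_lieC pcoef_ser.
  by apply: lie_F_G; [apply: dg|apply: sp| |]; lia.
- by move=> i hi; apply: lie_x_GS.
- by move=> i hi; apply: lie_y_GS.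
- by move=> i hi; apply: lie_x_FS_GS.
- move=> i j hi hj; rewrite lie_kappa_series; apply: pserP => m.
  by rewrite pcoef_lieC pcoef_ser lie_kappa_G //; [apply: sp|apply: dg]; lia.
- move=> i j hi hj; rewrite lie_kappa_ES ?cartan_far ?pserC0 ?mul0r ?mul0rn //;
    try apply: sp; lia.
- move=> i j hi hj; rewrite lie_kappa_FS ?cartan_far ?pserC0 ?mul0r ?mul0rn ?oppr0 //;
    try apply: sp; lia.
- move=> i hi hi1; rewrite lie_kappa_ES ?cartan_next; try (apply: sp; lia).
  by rewrite pserCN pserC1 mulN1r mulNrn.
- move=> i hi hi1; rewrite lie_kappa_FS ?cartan_next; try (apply: sp; lia).
  by rewrite pserCN pserC1 mulN1r mulNrn opprK.
- move=> i j hi hj; rewrite lie_kappa_series; apply: C0.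
  rewrite lie_kappa_E ?cartan_far ?mul0r ?mul0rn //; try apply: sp; lia.
- move=> i j hi hj; rewrite lie_kappa_series; apply: C0.
  rewrite lie_kappa_F ?cartan_far ?mul0r ?mul0rn ?oppr0 //; try apply: sp; lia.
- move=> i hi hi1; rewrite lie_kappa_series -pserC_lie lie_kappa_E ?cartan_next //;
    try (apply: sp; lia).
  by rewrite mulN1r; case: (flat _); rewrite ?mulr1n ?mulr0n ?oppr0 ?pserC0 ?pserCN.
- move=> i hi hi1; rewrite lie_kappa_series -pserC_lie lie_kappa_F ?cartan_next //;
    try (apply: sp; lia).
  by rewrite mulN1r mulNrn opprK; case: (flat _); rewrite ?mulr1n ?mulr0n ?pserC0.
- rewrite lie_kappa_ES ?cartan_diag; try (apply: sp; lia).
  by rewrite -mulrnDl; congr (_ *+ _); apply: pserP => m; rewrite pcoefCM pcoefD mulrDl mul1r.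
- rewrite lie_kappa_FS ?cartan_diag; try (apply: sp; lia).
  rewrite -mulrnDl; congr (- (_ *+ _)).
  by apply: pserP => m; rewrite pcoefCM pcoefD mulrDl mul1r.
- by apply: lie_x_ES1; apply: sp.
- by apply: lie_y_FS1; apply: sp.
Qed.

Definition drinfeld_e (k j : nat) (r : int) : A :=
  pcoef (gauss_e (fun i => x i) (fun i => ES i) k j) (absz r).
Definition drinfeld_f (j k : nat) (r : int) : A :=
  pcoef (gauss_f (fun i => y i) (fun i => FS i) j k) (absz r).
(** Taking the Gauss product as definition makes the second half of [RTT_rels] hold by
    computation. *)
Definition drinfeld_t (i j : nat) (r : int) : A :=
  \sum_(1 <= k < (minn i j).+1) fge_coef c drinfeld_e drinfeld_f D i k j r.

Lemma drinfeld_e_simple i r : 1 <= r -> drinfeld_e i i.+1 r = E i r.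
Proof.
move=> hr1; have er : (absz r)%:Z = r by lia.
by rewrite /drinfeld_e gauss_e_simple pcoef_ser subr0 er /Eh pos_part_ge.
Qed.
Lemma drinfeld_f_simple i r : 1 <= r -> drinfeld_f i.+1 i r = F i r.
Proof.
move=> hr1; have er : (absz r)%:Z = r by lia.
by rewrite /drinfeld_f gauss_f_simple pcoef_ser subr0 er /Fh pos_part_ge.
Qed.

Lemma gauss_e_coef0 k j : k != j -> pcoef (gauss_e (fun i => x i) (fun i => ES i) k j) 0 = 0.
Proof.
elim: j => [//|j IH] kj /=; rewrite (negbTE kj); have [_|kj'] := eqVneq k j.
  by rewrite pcoef_pos.
by rewrite pcoef_lieC IH ?lie0r.
Qed.
Lemma gauss_f_coef0 k j : k != j -> pcoef (gauss_f (fun i => y i) (fun i => FS i) j k) 0 = 0.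
Proof.
elim: j => [//|j IH] kj /=; rewrite (negbTE kj); have [_|kj'] := eqVneq k j.
  by rewrite pcoef_pos.
by rewrite pcoefN pcoef_lieC IH ?lie0r ?oppr0.
Qed.

Lemma ser_drinfeld_e k j : (0 < k)%N ->
  ser 0 (ehat drinfeld_e k j) = gauss_e (fun i => x i) (fun i => ES i) k j.
Proof.
move=> k0; apply: pserP => m; rewrite pcoef_ser subr0 /ehat /kd eqz_nat.
have [<-|kj] := eqVneq k j; first by rewrite gauss_e_diag.
by case: m => [|m]; rewrite ?gauss_e_coef0 // ifT.
Qed.
Lemma ser_drinfeld_f j k : (0 < k)%N ->
  ser 0 (fhat drinfeld_f j k) = gauss_f (fun i => y i) (fun i => FS i) j k.
Proof.
move=> k0; apply: pserP => m; rewrite pcoef_ser subr0 /fhat /kd eqz_nat.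
have [->|kj] := eqVneq j k; first by rewrite gauss_f_diag.
by case: m => [|m]; rewrite ?ifT // gauss_f_coef0 // eq_sym.
Qed.

Lemma drinfeld_t0 a b r : (0 < a <= n)%N -> (0 < b <= n)%N -> r < - c 1%N ->
  drinfeld_t a b r = 0.
Proof.
move=> ha hb hr1; rewrite /drinfeld_t big1_seq // => k /andP[_].
rewrite mem_index_iota => hk; apply: (fge_coef_lt _ _ _ (@dominant_le1)) => //.
by lia.
Qed.
Lemma ser_drinfeld_t a b : (0 < a <= n)%N -> (0 < b <= n)%N ->
  ser (c 1%N) (drinfeld_t a b) =
  gauss_t (fun i => x i) (fun i => y i) (fun i => GS i) (fun i => ES i) (fun i => FS i) a b.
Proof.
move=> ha hb; apply: pserP => m; rewrite pcoef_ser /gauss_t pcoef_sum.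
apply: eq_big_nat => k hk; rewrite (fge_coef_series _ _ _ (@dominant_le1)); last by lia.
by rewrite ser_drinfeld_e ?ser_drinfeld_f //; lia.
Qed.

Lemma drinfeld_RTT : RTT_rels n c drinfeld_t drinfeld_e drinfeld_f D.
Proof.
split=> [a b c' d' r s ha hb hc' hd'|//]; apply/subr0_eq.
have h1 : idx_diag n 1 by rewrite /idx_diag; lia.
have h2 : idx_diag n 2 by rewrite /idx_diag; lia.
have s1 : idx_simple n 1 by rewrite /idx_simple; lia.
have t11 q : drinfeld_t 1 1 q = G 1 q.
  have [lt|ge] : (q < - c 1%N \/ - c 1%N <= q) by lia.
    by rewrite drinfeld_t0 // ghat_lt.
  have [j ->] : exists j : nat, q = j%:Z - c 1%N by exists (absz (q + c 1%N)); lia.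
  have := congr1 (fun p => pcoef p j) (ser_drinfeld_t h1 h1).
  by rewrite gauss_t_diag // big_geq // add0r !pcoef_ser.
have t12 q : drinfeld_t 1 2 q = lie (E 1%N 1) (G 1 q).
  have [lt|ge] : (q < - c 1%N \/ - c 1%N <= q) by lia.
    by rewrite drinfeld_t0 // ghat_lt // lie0r.
  have [j ->] : exists j : nat, q = j%:Z - c 1%N by exists (absz (q + c 1%N)); lia.
  have := congr1 (fun p => pcoef p j) (ser_drinfeld_t h1 h2).
  rewrite /gauss_t big_nat1 gauss_f_diag // gauss_e_simple mul1r -lie_x_GS //.
  by rewrite pcoef_lieC !pcoef_ser.
have t21 q : drinfeld_t 2 1 q = - lie (F 1%N 1) (G 1 q).
  have [lt|ge] : (q < - c 1%N \/ - c 1%N <= q) by lia.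
    by rewrite drinfeld_t0 // ghat_lt // lie0r oppr0.
  have [j ->] : exists j : nat, q = j%:Z - c 1%N by exists (absz (q + c 1%N)); lia.
  have := congr1 (fun p => pcoef p j) (ser_drinfeld_t h2 h1).
  rewrite /gauss_t big_nat1 gauss_e_diag // gauss_f_simple mulr1.
  rewrite -[FS 1%N * GS 1%N]opprK -lie_y_GS //.
  by rewrite pcoefN pcoef_lieC !pcoef_ser.
apply: (gauss_rtt tf n2 drinfeld_gauss_rels drinfeld_t0 ser_drinfeld_t) => //.
- move=> q; apply: pserP => j; rewrite t11 pcoef_lieC pcoef_ser; exact: ghat_ghat.
- move=> q; apply: pserP => j; rewrite t11 pcoef_lieC pcoef_ser; exact: ghat_ghat.
- move=> q; apply: pserP => j; rewrite /rtt_der !t11 t12 pcoefB pcoef_lieC !pcoefXM.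
  case: j => [|j]; first by rewrite pcoef_pos lie0r subr0.
  rewrite pcoef_lieC pcoefB pcoefCM !pcoef_pos.
  case: j => [|j]; first by rewrite /= lie0r (lieC (E 1%N 1)) mulr0 !subr0 sub0r.
  rewrite /= !ghat_E // !kd_eq /= !sub0r !mulN1r.
  have -> : q + 1 - 1 = q by lia.
  (* Once the superscripts are aligned, both brackets sum the same terms, up to t = q and t = q - 1
     respectively; only the term t = q survives. *)
  have eE k t : q + 1 + k.+1%:Z - 1 - t = q + k.+2%:Z - 1 - t :> int by lia.
  under eq_isum => t _ do rewrite eE.
  have [lt|ge] : (q < - c 1%N \/ - c 1%N <= q) by lia.
    by rewrite !isum_empty ?ghat_lt //; [ncring|lia].
  rewrite (isum_recr _ ge) (_ : q + j.+2%:Z - 1 - q = j.+1%:Z); last by lia.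
  by ncring.
- move=> q; apply: pserP => j; rewrite /rtt_der !t11 t21 pcoefB pcoef_lieC !pcoefXM.
  case: j => [|j]; first by rewrite pcoef_pos lie0r subr0.
  rewrite pcoef_lieC pcoefB pcoefMC !pcoef_pos.
  case: j => [|j]; first by rewrite /= lie0r (lieC (F 1%N 1)) mul0r opprK !sub0r.
  rewrite /= !ghat_F // !kd_eq /= !subr0 !mul1r.
  have -> : q + 1 - 1 = q by lia.
  have eE k t : q + 1 + k.+1%:Z - 1 - t = q + k.+2%:Z - 1 - t :> int by lia.
  under eq_isum => t _ do rewrite eE.
  have [lt|ge] : (q < - c 1%N \/ - c 1%N <= q) by lia.
    by rewrite !isum_empty ?ghat_lt //; [ncring|lia].
  rewrite (isum_recr _ ge) (_ : q + j.+2%:Z - 1 - q = j.+1%:Z); last by lia.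
  by ncring.
Qed.
End DrinfeldGauss.

(** * Rigidity of solutions of the RTT relations *)

Section Triangular.
Variables (L : pzRingType) (m : nat) (f e : nat -> nat -> L) (g : nat -> L).
Hypothesis f_gt : forall a k, (a < k)%N -> f a k = 0.
Hypothesis e_gt : forall k b, (b < k)%N -> e k b = 0.
Hypothesis f_diag : forall k, (0 < k)%N -> f k k = 1.
Hypothesis e_diag : forall k, (0 < k)%N -> e k k = 1.
Hypothesis g_reg : forall k z, (0 < k <= m)%N -> g k * z = 0 -> z = 0.

Lemma big_nat_single (u : nat -> L) c : (0 < c <= m)%N ->
  (forall k, (0 < k <= m)%N -> k <> c -> u k = 0) -> \sum_(1 <= k < m.+1) u k = u c.
Proof.
move=> hc u0; rewrite (bigD1_seq c) ?mem_index_iota ?iota_uniq //= big1_seq ?addr0 //.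
by move=> k /andP[/eqP kc]; rewrite mem_index_iota => hk; apply: u0.
Qed.

Lemma lower_inj (Z : nat -> L) :
  (forall c, (0 < c <= m)%N -> \sum_(1 <= k < m.+1) f c k * g k * Z k = 0) ->
  forall c, (0 < c <= m)%N -> Z c = 0.
Proof.
move=> h; elim/ltn_ind => c IH hc; apply: (g_reg hc).
rewrite -(h c hc) (big_nat_single hc) ?f_diag ?mul1r //; first by case/andP: hc.
move=> k hk kc; have [lt|gt] : (k < c \/ c < k)%N by lia.
  by rewrite IH ?mulr0.
by rewrite f_gt // !mul0r.
Qed.

Lemma upper_inj (X : nat -> L) :
  (forall k, (0 < k <= m)%N -> \sum_(1 <= d < m.+1) e k d * X d = 0) ->
  forall k, (0 < k <= m)%N -> X k = 0.
Proof.
move=> h k; have [j] := ubnP (m - k); elim: j k => // j IH k lt hk.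
rewrite -(h k hk) (big_nat_single hk) ?e_diag ?mul1r //; first by case/andP: hk.
move=> d hd dk; have [ld|gd] : (d < k \/ k < d)%N by lia.
  by rewrite e_gt // mul0r.
by rewrite IH ?mulr0 //; lia.
Qed.

(** Back substitution from the last row. [P] is carried along because the solution must inherit a
    property of delta, in the application the vanishing of the constant term. *)
Lemma upper_solve (P : L -> Prop) (delta : nat -> L) :
  P 0 -> (forall a b, P a -> P b -> P (a - b)) -> (forall a b, P b -> P (a * b)) ->
  (forall k, P (delta k)) ->
  exists eta : nat -> L, (forall k, P (eta k)) /\
    forall k, (0 < k <= m)%N -> \sum_(1 <= d < m.+1) e k d * eta d = delta k.
Proof.
move=> P0 PB PM Pd.
have PN a : P a -> P (- a) by move=> ha; rewrite -sub0r; apply: PB.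
have PD a b : P a -> P b -> P (a + b) by move=> ha hb; rewrite -[b]opprK; apply: PB => //; apply: PN.
suff: forall j, exists eta : nat -> L, (forall k, P (eta k)) /\
    forall k, (0 < k <= m)%N -> (m - j < k)%N -> \sum_(1 <= d < m.+1) e k d * eta d = delta k.
  move=> /(_ m)[eta [Pe he]]; exists eta; split=> // k hk; apply: he => //; lia.
elim=> [|j [eta [Pe he]]]; first by exists (fun=> 0); split=> // k; lia.
pose k0 := (m - j)%N.
pose eta' k := if k == k0 then delta k0 - \sum_(1 <= d < m.+1 | d != k0) e k0 d * eta d else eta k.
exists eta'; split.
  move=> k; rewrite /eta'; case: ifP => // _; apply: PB => //.
  by elim/big_rec: _ => // i z _ hz; apply: PD => //; apply: PM.
move=> k hk ltk; have [lt|ek] : (m - j < k \/ k = k0)%N by rewrite /k0; lia.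
  rewrite -(he k hk lt); apply: eq_big_nat => d hd; rewrite /eta'; case: eqP => // ed.
  by rewrite ed e_gt ?mul0r //; rewrite /k0; lia.
rewrite ek (bigD1_seq k0) ?mem_index_iota ?iota_uniq //=; last by lia.
rewrite e_diag; last by lia.
rewrite /eta' eqxx mul1r -[RHS](subrK (\sum_(1 <= d < m.+1 | d != k0) e k0 d * eta d)).
by congr (_ + _); apply: eq_bigr => d /negbTE->.
Qed.

Definition tri_prod c d := \sum_(1 <= k < m.+1) f c k * g k * e k d.
Local Notation tau := tri_prod.

Lemma tri_prodM (X : nat -> L) c :
  \sum_(1 <= d < m.+1) tau c d * X d =
  \sum_(1 <= k < m.+1) f c k * g k * \sum_(1 <= d < m.+1) e k d * X d.
Proof.
under eq_bigr => d _ do rewrite mulr_suml.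
rewrite exchange_big; apply: eq_bigr => k _ /=; rewrite mulr_sumr.
by apply: eq_bigr => d _; rewrite !mulrA.
Qed.

Lemma tri_prod_inj (X : nat -> L) :
  (forall c, (0 < c <= m)%N -> \sum_(1 <= d < m.+1) tau c d * X d = 0) ->
  forall d, (0 < d <= m)%N -> X d = 0.
Proof.
move=> h; apply: upper_inj.
by apply: (@lower_inj (fun k => \sum_(1 <= d < m.+1) e k d * X d)) => c hc; rewrite -tri_prodM h.
Qed.

(* Expanding D (beta c) with the Leibniz rule and cancelling the block tau leaves an
   equation for each d; at d = m the term D (eta m) is zero. *)
Lemma column_rigid (D : L -> L) (v : L) (eta s p : nat -> L) (q : L) (a : nat) :
  (forall z z', D (z + z') = D z + D z') ->
  (forall z z', D (z * z') = D z * z' + z * D z') ->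
  (forall z, v * z = z * v) -> (0 < a <= m)%N -> eta m = 0 ->
  (forall c d, (0 < c <= m)%N -> (0 < d <= m)%N ->
     D (tau c d) = - (v * (s c * tau a d - tau c m * p d))) ->
  (forall c, (0 < c <= m)%N -> D (\sum_(1 <= d < m.+1) tau c d * eta d) =
     - (v * (s c * (\sum_(1 <= d < m.+1) tau a d * eta d) - tau c m * q))) ->
  v * (q - \sum_(1 <= d < m.+1) p d * eta d) = 0.
Proof.
move=> DD DM vC ha em Dtau Dbeta; set w := q - _.
have D0 : D 0 = 0 by apply: (addrI (D 0)); rewrite -DD !addr0.
have Dsum (u : nat -> L) : D (\sum_(1 <= d < m.+1) u d) = \sum_(1 <= d < m.+1) D (u d).
  by apply: big_morph.
have m0 : (0 < m <= m)%N by lia.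
(* After the Leibniz expansion, tau applied to D eta equals column m of tau times v w. So tau kills
   this X, and the entry at m reads - v w because eta_m = 0. *)
pose X d := D (eta d) - v * w *+ (d == m).
suff: X m = 0 by rewrite /X em D0 eqxx sub0r => /eqP; rewrite oppr_eq0 => /eqP.
apply: (tri_prod_inj _ m0) => c hc.
have eD := Dbeta c hc; rewrite Dsum in eD.
rewrite (eq_bigr _ (fun d _ => DM (tau c d) (eta d))) big_split /= in eD.
have eT : \sum_(1 <= d < m.+1) D (tau c d) * eta d =
    - (v * (s c * (\sum_(1 <= d < m.+1) tau a d * eta d)
            - tau c m * (\sum_(1 <= d < m.+1) p d * eta d))).
  rewrite !mulr_sumr -sumrB mulr_sumr -sumrN; apply: eq_big_nat => d hd.
  by rewrite Dtau //; ncring.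
have -> : \sum_(1 <= d < m.+1) tau c d * X d =
    \sum_(1 <= d < m.+1) tau c d * D (eta d) - tau c m * (v * w).
  have -> : tau c m * (v * w) = \sum_(1 <= d < m.+1) tau c d * (v * w *+ (d == m)).
    rewrite (big_nat_single m0) ?eqxx // => k _ /eqP/negbTE->.
    by rewrite mulr0n mulr0.
  by rewrite -sumrB; apply: eq_bigr => d _; rewrite -mulrBr.
move: eD; rewrite eT => /(canRL (addKr _)) ->; rewrite /w.
have -> u : tau c m * (v * u) = v * tau c m * u by rewrite mulrA vC.
by ncring.
Qed.
End Triangular.

(** * Gauss factors of an arbitrary RTT solution as triangular matrices of power series *)

Section RTTSeries.
Variables (A : pzRingType) (n : nat) (c : nat -> int).
Hypothesis hdom : dominant n c.
Variables (t e f : nat -> nat -> int -> A) (g : nat -> int -> A).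
Hypothesis hR : RTT_rels n c t e f g.

(** Below the diagonal [ehat] has unconstrained values; the test makes the matrix truly triangular,
    so Gauss sums can run up to a common m. *)
Definition upper_series (k b : nat) : pser A :=
  if (k <= b)%N then ser 0 (ehat e k b) else 0.
Definition lower_series (a k : nat) : pser A :=
  if (k <= a)%N then ser 0 (fhat f a k) else 0.
Definition diag_series (k : nat) : pser A := ser (c 1%N) (ghat c g k).

Lemma upper_series_gt k b : (b < k)%N -> upper_series k b = 0.
Proof. by move=> h; rewrite /upper_series leqNgt h. Qed.
Lemma lower_series_gt a k : (a < k)%N -> lower_series a k = 0.
Proof. by move=> h; rewrite /lower_series leqNgt h. Qed.
Lemma upper_series_diag k : (0 < k)%N -> upper_series k k = 1.
Proof.
move=> k0; apply: pserP => m; rewrite /upper_series leqnn pcoef_ser subr0 /ehat eqxx.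
by rewrite /kd eqz_nat.
Qed.
Lemma lower_series_diag k : (0 < k)%N -> lower_series k k = 1.
Proof.
move=> k0; apply: pserP => m; rewrite /lower_series leqnn pcoef_ser subr0 /fhat eqxx.
by rewrite /kd eqz_nat.
Qed.
Lemma upper_series_coef k b m : (k < b)%N ->
  pcoef (upper_series k b) m = if m is 0 then 0 else e k b m.
Proof.
move=> h; rewrite /upper_series ltnW // pcoef_ser subr0 /ehat ltn_eqF //.
by case: m.
Qed.
Lemma lower_series_coef a k m : (k < a)%N ->
  pcoef (lower_series a k) m = if m is 0 then 0 else f a k m.
Proof.
move=> h; rewrite /lower_series ltnW // pcoef_ser subr0 /fhat eq_sym ltn_eqF //.
by case: m.
Qed.
Lemma diag_series_monic k : (0 < k <= n)%N -> monic_at (absz (c 1%N - c k)) (diag_series k).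
Proof.
move=> hk; have ck := dominant_le1 hdom hk; split.
  by rewrite pcoef_ser /ghat ifT //; lia.
by move=> j hj; rewrite pcoef_ser /ghat ifF ?ifF //; lia.
Qed.

Lemma rtt_t0 a b r : (0 < a <= n)%N -> (0 < b <= n)%N -> r < - c 1%N -> t a b r = 0.
Proof.
move=> ha hb hr; case: hR => _ ->; try by rewrite /idx_diag.
rewrite big1_seq // => k /andP[_]; rewrite mem_index_iota => hk.
by apply: (fge_coef_lt _ _ _ (dominant_le1 hdom)) => //; lia.
Qed.

Lemma rtt_series m a b : (0 < a <= n)%N -> (0 < b <= n)%N ->
  (minn a b <= m <= n)%N -> ser (c 1%N) (t a b) =
  \sum_(1 <= k < m.+1) lower_series a k * diag_series k * upper_series k b.
Proof.
move=> ha hb hm; rewrite (@big_cat_nat _ _ _ (minn a b).+1) //=; last by lia.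
rewrite [X in _ + X]big1_seq ?addr0; last first.
  move=> k /andP[_]; rewrite mem_index_iota => hk.
  have [lt|lt] : (a < k \/ b < k)%N by lia.
    by rewrite lower_series_gt // !mul0r.
  by rewrite upper_series_gt // mulr0.
apply: pserP => j; rewrite pcoef_ser pcoef_sum; case: hR => _ ->; try by rewrite /idx_diag.
apply: eq_big_nat => k hk; rewrite (fge_coef_series _ _ _ (dominant_le1 hdom)); last by lia.
by rewrite /lower_series /upper_series !ifT //; lia.
Qed.

Lemma rtt_defect0 r s a b c' d : (0 < a <= n)%N -> (0 < b <= n)%N ->
  (0 < c' <= n)%N -> (0 < d <= n)%N -> rtt_defect t r s a b c' d = 0.
Proof.
by move=> ha hb hc hd; rewrite /rtt_defect; case: hR => -> // _; rewrite subrr.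
Qed.

Lemma rtt_derE r a b c' d : (0 < a <= n)%N -> (0 < b <= n)%N ->
  (0 < c' <= n)%N -> (0 < d <= n)%N ->
  rtt_der t r a b (ser (c 1%N) (t c' d)) =
    - (pserX * (pserC (t c' b r) * ser (c 1%N) (t a d)
                - ser (c 1%N) (t c' b) * pserC (t a d r))).
Proof.
move=> ha hb hc hd; apply/(rtt_defect_series rtt_t0) => // s.
exact: rtt_defect0.
Qed.
End RTTSeries.

(** * Comparison of two solutions with the same g_i, e_{i,i+1} and f_{i+1,i} *)

Section Rigidity.
Variables (A : pzRingType) (n : nat) (c : nat -> int).
Hypothesis hdom : dominant n c.
Variables (t e f t' e' f' : nat -> nat -> int -> A) (g g' : nat -> int -> A).
Hypothesis hR : RTT_rels n c t e f g.
Hypothesis hR' : RTT_rels n c t' e' f' g'.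
Hypothesis hg : forall k r, (0 < k <= n)%N -> 1 - c k <= r -> g k r = g' k r.
Hypothesis he : forall i r, (0 < i < n)%N -> 1 <= r -> e i i.+1 r = e' i i.+1 r.
Hypothesis hf : forall i r, (0 < i < n)%N -> 1 <= r -> f i.+1 i r = f' i.+1 i r.

Local Notation U := (upper_series e).
Local Notation U' := (upper_series e').
Local Notation V := (lower_series f).
Local Notation V' := (lower_series f').
Local Notation W := (diag_series c g).
Local Notation T a b := (ser (c 1%N) (t a b)).
Local Notation T' a b := (ser (c 1%N) (t' a b)).

Definition agree_upto (m : nat) : Prop := forall k j,
  (0 < k <= j)%N -> (j <= m)%N -> U k j = U' k j /\ V j k = V' j k.

Lemma diag_seriesE k : (0 < k <= n)%N -> diag_series c g' k = W k.
Proof.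
move=> hk; apply: pserP => j; rewrite !pcoef_ser /ghat.
by case: ifP => // _; case: ifP => // h; rewrite hg.
Qed.

Lemma block_series m a b : agree_upto m -> (m <= n)%N ->
  (0 < a <= m)%N -> (0 < b <= m)%N -> T a b = T' a b.
Proof.
move=> hm mn ha hb.
rewrite (rtt_series hdom hR (m := m)); try lia.
rewrite (rtt_series hdom hR' (m := m)); try lia.
apply: eq_big_nat => k hk; rewrite diag_seriesE; last by lia.
have eU : U k b = U' k b.
  have [le|gt] : (k <= b \/ b < k)%N by lia.
    by case: (hm k b _ _) => //; lia.
  by rewrite !upper_series_gt.
have eV : V a k = V' a k.
  have [le|gt] : (k <= a \/ a < k)%N by lia.
    by case: (hm k a _ _) => //; lia.
  by rewrite !lower_series_gt.
by rewrite eU eV.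
Qed.

Lemma series_eq_coef a b r : (0 < a <= n)%N -> (0 < b <= n)%N -> T a b = T' a b ->
  t a b r = t' a b r.
Proof.
move=> ha hb eT; have [lt|ge] : (r < - c 1%N \/ - c 1%N <= r) by lia.
  by rewrite (rtt_t0 hdom hR) // (rtt_t0 hdom hR').
have [j ->] : exists j : nat, r = j%:Z - c 1%N by exists (absz (r + c 1%N)); lia.
exact: (congr1 (fun p => pcoef p j) eT).
Qed.

Lemma agree_column m : (0 < m < n)%N -> agree_upto m ->
  forall k, (0 < k <= m)%N -> U k m.+1 = U' k m.+1.
Proof.
move=> hm hA.
have mn : (m <= n)%N by lia.
have m0 : (0 < m <= m)%N by lia.
pose delta k := U k m.+1 - U' k m.+1.
have g_reg k z : (0 < k <= m)%N -> W k * z = 0 -> z = 0.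
  by move=> hk; apply: (monic_at_lreg (diag_series_monic hdom g (_ : 0 < k <= n)%N)); lia.
(* Solving U eta = delta turns the difference of the new columns into T eta. Constant terms vanish
   because the e-series begin at z^-1. *)
have [eta [eta0 etaE]] : exists eta : nat -> pser A, (forall k, pcoef (eta k) 0 = 0) /\
    forall k, (0 < k <= m)%N -> \sum_(1 <= d < m.+1) U k d * eta d = delta k.
  apply: (upper_solve m (upper_series_gt e) (upper_series_diag e)
           (P := fun p => pcoef p 0 = 0)) => //.
  - by move=> a b ha hb; rewrite pcoefB ha hb subr0.
  - by move=> a b hb; rewrite pcoefM big_ord1 subn0 hb mulr0.
  - move=> k; rewrite /delta pcoefB; have [lt|[ek|gt]] : (k < m.+1 \/ k = m.+1 \/ m.+1 < k)%N by lia.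
    + by rewrite !upper_series_coef // subr0.
    + by rewrite ek !upper_series_diag // subrr.
    + by rewrite !upper_series_gt // subr0.
(* Row m of U reduces to its diagonal 1 within the block, so eta_m = delta_m, which compares
   e_{m,m+1} and e'_{m,m+1}. *)
have eta_m : eta m = 0.
  have := etaE m m0; rewrite (big_nat_single m0) ?upper_series_diag ?mul1r; last first.
  - move=> d hd dm; rewrite upper_series_gt ?mul0r //; lia.
  - by lia.
  move=> ->; rewrite /delta; apply/eqP; rewrite subr_eq0; apply/eqP/pserP => j.
  by rewrite !upper_series_coef //; case: j => // j; rewrite he.
have tauE a b : (0 < a <= m)%N -> (0 < b <= m)%N ->
    T a b = tri_prod m V U W a b.
  by move=> ha hb; apply: (rtt_series hdom hR); lia.
have betaE a : (0 < a <= m)%N -> T a m.+1 - T' a m.+1 =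
    \sum_(1 <= k < m.+1) V a k * W k * delta k.
  move=> ha; rewrite (rtt_series hdom hR (m := m)); try lia.
  rewrite (rtt_series hdom hR' (m := m)); try lia.
  rewrite -sumrB; apply: eq_big_nat => k hk; rewrite diag_seriesE; last by lia.
  have -> : V' a k = V a k.
    have [le|gt] : (k <= a \/ a < k)%N by lia.
      by case: (hA k a _ _) => //; lia.
    by rewrite !lower_series_gt.
  by rewrite -mulrBr.
have beta_eta a : (0 < a <= m)%N ->
    \sum_(1 <= d < m.+1) tri_prod m V U W a d * eta d = T a m.+1 - T' a m.+1.
  by move=> ha; rewrite tri_prodM betaE //; apply: eq_big_nat => k hk; rewrite etaE.
have tt a b r : (0 < a <= m)%N -> (0 < b <= m)%N -> t a b r = t' a b r.
  by move=> ha hb; apply: series_eq_coef; [lia|lia|apply: (block_series hA)].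
have key a r : (0 < a <= m)%N -> t a m.+1 r = t' a m.+1 r.
  move=> ha.
  pose q := pserC (t a m.+1 r) - pserC (t' a m.+1 r).
  pose p d := pserC (t a d r).
  have : pserX * (q - \sum_(1 <= d < m.+1) p d * eta d) = 0.
    apply: (column_rigid (lower_series_gt f) (upper_series_gt e)
      (lower_series_diag f) (upper_series_diag e) g_reg (D := rtt_der t r a m)
      (s := fun c' => pserC (t c' m r)) _ _ (@pserX_comm _) ha eta_m).
    - exact: rtt_derD.
    - exact: rtt_derM.
    - move=> c' d hc' hd; rewrite -!tauE // (rtt_derE hdom hR) //; lia.
    - move=> c' hc'; rewrite !beta_eta // -tauE //.
      have derB u v : rtt_der t r a m (u - v) = rtt_der t r a m u - rtt_der t r a m v.
        by rewrite /rtt_der !lierB; ncring.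
      (* The derivation only involves t_{am}, an entry of the common block, so both RTT relations
         can be subtracted. *)
      have ett z : rtt_der t r a m z = rtt_der t' r a m z by rewrite /rtt_der !tt.
      rewrite derB [X in _ - X]ett (rtt_derE hdom hR) ?(rtt_derE hdom hR') //; try natlia.
      rewrite -(block_series hA mn hc' m0) -(tt c' m r hc' m0) /q; ncring.
  (* q is a constant series and every eta d has zero constant term, so degree 0 gives q = 0. *)
  move=> /pserXI/(congr1 (fun z => pcoef z 0)).
  rewrite pcoefB pcoef_sum big1 ?subr0 => [|d _]; last by rewrite pcoefCM eta0 mulr0.
  by rewrite /q pcoefB /= => /eqP; rewrite subr_eq0 => /eqP.
move=> k hk; apply/eqP; rewrite -subr_eq0; apply/eqP.
apply: (lower_inj (lower_series_gt f) (lower_series_diag f) g_reg (Z := delta) _ hk) => a ha.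
rewrite -betaE //; apply/eqP; rewrite subr_eq0; apply/eqP/pserP => j.
by rewrite !pcoef_ser key.
Qed.

Lemma agree_row m : (0 < m < n)%N -> agree_upto m ->
  forall k, (0 < k <= m)%N -> V m.+1 k = V' m.+1 k.
Proof.
move=> hm hA.
have mn : (m <= n)%N by lia.
have m0 : (0 < m <= m)%N by lia.
(* In the converse ring the transposed block is again a product lower, diagonal, upper, with U as
   lower and V as upper factor, so a row becomes a column. *)
pose L : pzRingType := (pser A)^c.
pose lf (a k : nat) : L := U k a.
pose le (k b : nat) : L := V b k.
pose lg (k : nat) : L := W k.
have mulLE (u v : L) : u * v = (v : pser A) * (u : pser A) by [].
have lf_gt a k : (a < k)%N -> lf a k = 0 by apply: upper_series_gt.
have le_gt k b : (b < k)%N -> le k b = 0 by apply: lower_series_gt.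
have lf_diag k : (0 < k)%N -> lf k k = 1 by apply: upper_series_diag.
have le_diag k : (0 < k)%N -> le k k = 1 by apply: lower_series_diag.
pose delta k : L := V m.+1 k - V' m.+1 k.
have g_reg k (z : L) : (0 < k <= m)%N -> lg k * z = 0 -> z = 0.
  move=> hk; rewrite mulLE.
  by apply: (monic_at_rreg (diag_series_monic hdom g (_ : 0 < k <= n)%N)); lia.
have [eta [eta0 etaE]] : exists eta : nat -> L,
    (forall k, pcoef (eta k : pser A) 0 = 0) /\
    forall k, (0 < k <= m)%N -> \sum_(1 <= d < m.+1) le k d * eta d = delta k.
  apply: (upper_solve m le_gt le_diag (P := fun p => pcoef (p : pser A) 0 = 0)) => //.
  - by move=> a b ha hb; rewrite pcoefB ha hb subr0.
  - by move=> a b hb; rewrite mulLE pcoefM big_ord1 subn0 hb mul0r.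
  - move=> k; rewrite /delta pcoefB; have [lt|[ek|gt]] : (k < m.+1 \/ k = m.+1 \/ m.+1 < k)%N by lia.
    + by rewrite !lower_series_coef // subr0.
    + by rewrite ek !lower_series_diag // subrr.
    + by rewrite !lower_series_gt // subr0.
have eta_m : eta m = 0.
  have := etaE m m0; rewrite (big_nat_single m0) ?le_diag ?mul1r; last first.
  - move=> d hd dm; rewrite le_gt ?mul0r //; lia.
  - by lia.
  move=> ->; rewrite /delta; apply/eqP; rewrite subr_eq0; apply/eqP/pserP => j.
  by rewrite !lower_series_coef //; case: j => // j; rewrite hf.
have tauE a b : (0 < a <= m)%N -> (0 < b <= m)%N ->
    tri_prod m lf le lg a b = (T b a : L).
  move=> ha hb; rewrite (rtt_series hdom hR (m := m)); try lia.
  by apply: eq_big_nat => k hk; rewrite !mulLE mulrA.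
have betaE a : (0 < a <= m)%N -> (T m.+1 a - T' m.+1 a : L) =
    \sum_(1 <= k < m.+1) lf a k * lg k * delta k.
  move=> ha; rewrite (rtt_series hdom hR (m := m)); try lia.
  rewrite (rtt_series hdom hR' (m := m)); try lia.
  rewrite -sumrB; apply: eq_big_nat => k hk; rewrite diag_seriesE; last by lia.
  have -> : U' k a = U k a.
    have [le'|gt] : (k <= a \/ a < k)%N by lia.
      by case: (hA k a _ _) => //; lia.
    by rewrite !upper_series_gt.
  rewrite -[RHS]/((V m.+1 k - V' m.+1 k) * (W k * U k a) : pser A).
  by rewrite mulrBl !mulrA.
have beta_eta a : (0 < a <= m)%N ->
    \sum_(1 <= d < m.+1) tri_prod m lf le lg a d * eta d = (T m.+1 a - T' m.+1 a : L).
  by move=> ha; rewrite tri_prodM betaE //; apply: eq_big_nat => k hk; rewrite etaE.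
have tt a b r : (0 < a <= m)%N -> (0 < b <= m)%N -> t a b r = t' a b r.
  by move=> ha hb; apply: series_eq_coef; [lia|lia|apply: (block_series hA)].
have key a r : (0 < a <= m)%N -> t m.+1 a r = t' m.+1 a r.
  move=> ha.
  pose q : L := pserC (t m.+1 a r) - pserC (t' m.+1 a r).
  pose p d : L := pserC (t d a r).
  have : (pserX : L) * (q - \sum_(1 <= d < m.+1) p d * eta d) = 0.
    (* Reversing the products swaps the two terms on the right of the RTT relation; the minus sign
       in D compensates. *)
    apply: (column_rigid lf_gt le_gt lf_diag le_diag g_reg
      (D := fun z => - rtt_der t r m a z)
      (s := fun c' => pserC (t m c' r)) _ _ (_ : forall z : L, (pserX : L) * z = z * pserX) ha eta_m).
    - by move=> z z'; rewrite rtt_derD opprD.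
    - by move=> z z'; rewrite !mulLE rtt_derM opprD addrC mulrN mulNr.
    - by move=> z; rewrite !mulLE pserX_comm.
    - move=> c' d hc' hd; rewrite !tauE // (rtt_derE hdom hR); try natlia.
      by rewrite !mulLE pserX_comm; congr (- _); rewrite -mulNr opprB.
    - move=> c' hc'; rewrite !beta_eta // tauE //.
      change (- rtt_der t r m a (T m.+1 c' - T' m.+1 c') =
        - (((T m.+1 a - T' m.+1 a) * pserC (t m c' r)
            - (pserC (t m.+1 a r) - pserC (t' m.+1 a r)) * T m c') * pserX) :> pser A).
      have derB u v : rtt_der t r m a (u - v) = rtt_der t r m a u - rtt_der t r m a v.
        by rewrite /rtt_der !lierB; ncring.
      have ett z : rtt_der t r m a z = rtt_der t' r m a z by rewrite /rtt_der !tt.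
      rewrite derB [X in _ - X]ett (rtt_derE hdom hR) ?(rtt_derE hdom hR') //; try natlia.
      rewrite -(block_series hA mn m0 hc') -(tt m c' r m0 hc') -pserX_comm; ncring.
  rewrite mulLE -pserX_comm => /pserXI/(congr1 (fun z => pcoef z 0)).
  rewrite pcoefB pcoef_sum big1 ?subr0 => [|d _]; last by rewrite mulLE pcoefMC eta0 mul0r.
  by rewrite /q pcoefB /= => /eqP; rewrite subr_eq0 => /eqP.
move=> k hk; apply/eqP; rewrite -subr_eq0; apply/eqP.
apply: (lower_inj lf_gt lf_diag g_reg (Z := delta) _ hk) => a ha.
rewrite -betaE //; apply/eqP; rewrite subr_eq0; apply/eqP/pserP => j.
by rewrite !pcoef_ser key.
Qed.

Lemma agree_all m : (m <= n)%N -> agree_upto m.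
Proof.
elim: m => [|m IH] hm k j hk hj; first by lia.
have {}IH := IH (ltnW hm).
have [jm|->] : (j <= m \/ j = m.+1)%N by lia.
  exact: IH.
have [km|ek] : (k <= m \/ k = m.+1)%N by lia.
  have hm' : (0 < m < n)%N by lia.
  have hk' : (0 < k <= m)%N by lia.
  by rewrite (agree_column hm' IH hk') (agree_row hm' IH hk').
by rewrite ek !upper_series_diag ?lower_series_diag.
Qed.

Lemma rtt_rigid : agree_rtt n c t e f g t' e' f' g'.
Proof.
have hA := agree_all (leqnn n).
split; [|split] => [i j r hi hj|i j r hi hj ij hr|i r hi hr].
- by apply: series_eq_coef => //; apply: (block_series hA).
- have er : r = (absz r)%:Z by lia.
  have hj' : (j <= n)%N by move: hj; rewrite /idx_diag; lia.
  have hi' : (0 < i <= j)%N by move: hi; rewrite /idx_diag; lia.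
  have [/(congr1 (fun p => pcoef p (absz r))) + /(congr1 (fun p => pcoef p (absz r)))] := hA i j hi' hj'.
  rewrite !upper_series_coef // !lower_series_coef // er.
  by case: (absz r) er hr => [->|k _ _].
- exact: hg.
Qed.
End Rigidity.

(** * The isomorphism *)

Section Morphisms.
Variables (A B : pzRingType) (phi : {rmorphism A -> B}).

Lemma rmorph_isum lo hi (h : int -> A) :
  phi (isum lo hi h) = isum lo hi (fun k => phi (h k)).
Proof. by rewrite /isum; case: ifP => _; rewrite ?rmorph0 ?rmorph_sum. Qed.
Lemma rmorph_kd i j : phi (kd A i j) = kd B i j.
Proof. by rewrite /kd; case: ifP => _; rewrite ?rmorph0 ?rmorph1. Qed.

Lemma RTT_rels_map n c t e f g : RTT_rels n c t e f g ->
  RTT_rels n c (fam_map2 phi t) (fam_map2 phi e) (fam_map2 phi f) (fam_map phi g).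
Proof.
move=> [R1 R2]; split=> [a b c' d r s ha hb hc hd|i j r hi hj].
  have := congr1 phi (R1 a b c' d r s ha hb hc hd).
  by rewrite /fam_map2 !(rmorphD, rmorphN, rmorphM).
rewrite /fam_map2 R2 // rmorph_sum; apply: eq_bigr => k _.
rewrite /fge_coef rmorph_isum; apply: eq_isum => a _.
rewrite rmorph_isum; apply: eq_isum => b _; rewrite !rmorphM; congr (_ * _ * _).
- by rewrite /fhat; case: ifP => _; [rewrite rmorph_kd|case: ifP => _; rewrite ?rmorph0].
- by rewrite /ghat; case: ifP => _; [rewrite rmorph1|case: ifP => _; rewrite ?rmorph0].
- by rewrite /ehat; case: ifP => _; [rewrite rmorph_kd|case: ifP => _; rewrite ?rmorph0].
Qed.
End Morphisms.

(** The map is prescribed on E, F and D only, while uniqueness in the universal property also asks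
    about Dt; being an inverse series up to sign, Dt is determined by D. *)
Lemma inverse_unique (A : pzRingType) (p : int) (D Dt Dt' : int -> A) :
  D (- p) = 1 ->
  (forall r, isum (- p) (r - p) (fun t => D t * Dt (r - t)) = - kd A r 0) ->
  (forall r, isum (- p) (r - p) (fun t => D t * Dt' (r - t)) = - kd A r 0) ->
  forall r, p <= r -> Dt r = Dt' r.
Proof.
move=> D1 h h' r hr.
pose cut (lo : int) (u : int -> A) (k : int) := if (lo <= k)%R then u k else 0.
have ser_inv u : (forall r, isum (- p) (r - p) (fun t => D t * u (r - t)) = - kd A r 0) ->
    ser p (cut (- p) D) * ser (- p) (cut p u) = -1.
  move=> hu; apply: pserP => m.
  rewrite -(@isum_conv _ (- p) (m%:Z - p) p (- p) m _ _ m%:Z); first last.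
  - by move=> k hk; rewrite /cut ifF //; lia.
  - by move=> k hk; rewrite /cut ifF //; lia.
  - by lia.
  - by lia.
  - by lia.
  transitivity (isum (- p) (m%:Z - p) (fun t => D t * u (m%:Z - t))).
    by apply: eq_isum => k hk; rewrite /cut !ifT //; lia.
  by rewrite hu pcoefN pcoef1 /kd eqz_nat.
have cutD : monic_at 0 (ser p (cut (- p) D)).
  by split=> //; rewrite pcoef_ser sub0r /cut ifT ?D1 // Order.POrderTheory.lexx.
have : ser p (cut (- p) D) * (ser (- p) (cut p Dt) - ser (- p) (cut p Dt')) = 0.
  by rewrite mulrBr !ser_inv // subrr.
move=> /(monic_at_lreg cutD)/(congr1 (fun s => pcoef s (absz (r - p)))).
have -> : Dt r = cut p Dt ((absz (r - p))%:Z - - p).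
  by rewrite /cut ifT; [congr (Dt _)|]; lia.
have -> : Dt' r = cut p Dt' ((absz (r - p))%:Z - - p).
  by rewrite /cut ifT; [congr (Dt' _)|]; lia.
by rewrite pcoefB => /eqP; rewrite subr_eq0 => /eqP.
Qed.

(** The base field enters here: 2 is invertible in it. *)
Lemma alg_two_tf (A : algType CC) (z : A) : z + z = 0 -> z = 0.
Proof.
have two : (2%:R : CC) != 0.
  by change ((2%:R : (Rdefinitions.R)[i]) != 0); rewrite pnatr_eq0.
move=> zz; apply: (scalerI two); rewrite scaler0 -zz.
by rewrite -[2%:R]/(1 + 1) scalerDl scale1r.
Qed.

Unset Implicit Arguments.

(* mu = sum_j c_j eps_j in Lambda^+, nu = -mu so d_j = - c_j.
   Upsilon : Y_{-mu} -> Y^rtt_{-mu} is the algebra map with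
   E_i^{(r)} |-> e_{i,i+1}^{(r)}, F_i^{(r)} |-> f_{i+1,i}^{(r)},
   D_j^{(r)} |-> g_j^{(r)} (r >= 1 - c_j; D_j^{(-c_j)} = 1 |-> 1 automatically).
   Claim: Upsilon is bijective (an isomorphism). *)
Theorem theorem2p19 (n : nat) (hn : (2 <= n)%N) (c : nat -> int)
  (hmu : dominant n c)
  (Y : algType CC) (E F D Dt : nat -> int -> Y)
  (hY : is_Drinfeld_shifted_yangian n (fun j => - c j) E F D Dt)
  (Yrtt : algType CC) (t e f : nat -> nat -> int -> Yrtt) (g : nat -> int -> Yrtt)
  (hYrtt : is_RTT_shifted_yangian n c t e f g)
  (Ups : {lrmorphism Y -> Yrtt})
  (hE : forall i r, (1 <= i < n)%N -> 1 <= r -> Ups (E i r) = e i i.+1 r)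
  (hF : forall i r, (1 <= i < n)%N -> 1 <= r -> Ups (F i r) = f i.+1 i r)
  (hD : forall j r, (1 <= j <= n)%N -> 1 - c j <= r -> Ups (D j r) = g j r) :
  bijective Ups.
Proof.
case: hY hYrtt => rY uY [rR uR].
have rY' := drinfeld_RTT hmu rY (@alg_two_tf Y) hn.
have [psi [[_ [psi_ef psi_g]] _]] := uR _ _ _ _ _ rY'.
have psi_e i r : (1 <= i < n)%N -> 1 <= r -> psi (e i i.+1 r) = E i r.
  move=> hi hr; rewrite -(drinfeld_e_simple E hn) //.
  by apply: (psi_ef i i.+1 r _ _ _ _).1; rewrite /idx_diag; lia.
have psi_f i r : (1 <= i < n)%N -> 1 <= r -> psi (f i.+1 i r) = F i r.
  move=> hi hr; rewrite -(drinfeld_f_simple F hn) //.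
  by apply: (psi_ef i i.+1 r _ _ _ _).2; rewrite /idx_diag; lia.
case: (rY) => D1 [DDt _].
have psiD i r : idx_diag n i -> - c i <= r -> psi (Ups (D i r)) = D i r.
  (* [hD] omits the leading superscript, where D is 1 and any morphism preserves it. *)
  move=> hi hr; have [->|lt] : (r = - c i \/ 1 - c i <= r) by lia.
    by rewrite D1 // !rmorph1.
  by rewrite hD //; apply: psi_g.
exists psi => z.
(* With Y itself as target, uniqueness identifies the composite and the identity, each with phi. *)
- have [phi [_ phiU]] := uY Y E F D Dt rY.
  transitivity (phi z).
    apply: (phiU (psi \o Ups)); split; [|split] => [i r hi hr|i r hi hr|i r hi hr].
    + by rewrite /fam_map /= hE // hF // psi_e // psi_f.
    + by rewrite /fam_map /= psiD.
    + rewrite opprK in hr; rewrite /fam_map.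
      apply: (@inverse_unique _ (c i) (D i) (fun r => psi (Ups (Dt i r))) (Dt i)) => //.
      * exact: D1.
      * move=> q; rewrite -(rmorph_kd (psi \o Ups)) -rmorphN -(DDt i q hi).
        rewrite (rmorph_isum (psi \o Ups)); apply: eq_isum => k hk.
        by rewrite (rmorphM (psi \o Ups)) /= psiD //; lia.
      * by move=> q; apply: DDt.
  by symmetry; apply: (phiU idfun); split; [|split].
- have [phi [_ phiU]] := uR Yrtt t e f g rR.
  transitivity (phi z).
    apply: (phiU (Ups \o psi)).
    (* Uniqueness asks for agreement on all of t, e, f and g, but the composite is controlled only
       on g and the neighbouring e and f; rigidity supplies the rest. *)
    apply: (rtt_rigid hmu (RTT_rels_map (Ups \o psi) rR) rR) => [k r hk hr|i r hi hr|i r hi hr].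
    + by rewrite /fam_map /= -hD // psiD //; lia.
    + by rewrite /fam_map2 /= psi_e // hE.
    + by rewrite /fam_map2 /= psi_f // hF.
  by symmetry; apply: (phiU idfun); split; [|split].
Qed.
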